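(* Let $D_-$ and $D_+$ be oriented link diagrams that are identical except at one crossing $c_0$, which is negative in $D_-$ and positive in $D_+$. Suppose $c_0$ is reducible in the following sense: turning the plane so that both strands point upward at $c_0$, the diagram consists of $c_0$, a part $D'$ contained in a box to the left of $c_0$ and a part $D''$ contained in a box to the right of $c_0$, the boxes being disjoint; the two left ends (SW, NW) at $c_0$ are attached to $D'$, the two right ends (SE, NE) are attached to $D''$, and there are no other connections between $c_0$, $D'$ and $D''$. Then the genus-one morphism $$\widehat\Phi:[\![D_-]\!]\to[\![D_+]\!]$$ at the crossing $c_0$ is a chain homotopy equivalence.
   Context: **Cobordism category.** $k$ is a fixed commutative ring. $\mathrm{Cob}_2^\ell(\varnothing,\varnothing)$ is Bar-Natan's category: the additive closure of the $k$-linear category whose objects are closed oriented $1$-manifolds and whose morphisms $W_0\to W_1$ are $k$-linear combinations of diffeomorphism classes (rel boundary) of compact oriented $2$-dimensional cobordisms from $W_0$ to $W_1$, modulo the relations: (S) $S\amalg S^2=0$; (T) $S\amalg T^2=2S$; (4Tu) if $S$ carries four disjoint discs $1,2,3,4$ and $S_{ij}$ is obtained by removing discs $i,j$ and gluing in a tube joining their boundaries, then $S_{12}+S_{34}=S_{13}+S_{24}$. **Khovanov complex.** For an oriented link diagram $D$ with set of crossings $c(D)$ (chosen totally ordered), turn each crossing so that its strands point upward; its vertical smoothing consists of arcs SW–NW and SE–NE, its horizontal smoothing of arcs SW–SE and NW–NE. For $\alpha:c(D)\to\mathbb Z$ with $\alpha(v)\in\{-1,0\}$ at negative crossings and $\alpha(v)\in\{0,1\}$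 at positive crossings, $|D_\alpha|$ is the closed $1$-manifold obtained by using the vertical smoothing where $\alpha(v)=0$ and the horizontal one where $\alpha(v)=\pm1$; it is oriented as the boundary of the black region for a fixed checkerboard coloring of the complement of $D$. For other $\alpha$ put $|D_\alpha|=0$. Then $[\![D]\!]$ is the cohomological complex in $\mathrm{Cob}_2^\ell(\varnothing,\varnothing)$ with $[\![D]\!]^n=\bigoplus_{|\alpha|=n}|D_\alpha|$, $|\alpha|=\sum_v\alpha(v)$, and differential on $|D_\alpha|$ equal to $\sum_v(-1)^{\sum_{v'>v}\alpha(v')}d_v$, where $d_v:|D_\alpha|\to|D_{\alpha+v}|$ is the saddle at $v$ if $v$ is negative and minus the saddle if $v$ is positive. **Genus-one morphism.** Let $D_\pm$ be as in the claim, with the same coloring and the same order on crossings. For $\alpha$ with $\alpha(c_0)=0$ we have $|(D_-)_\alpha|=|(D_+)_\alpha|$, and both contain the two vertical strands at $c_0$. Let $\Phi:|(D_-)_\alpha|\to|(D_+)_\alpha|$ be (the identity cobordism with a tube added joining the sheets of these two strands) minus (the identity cobordism with one handle added to the sheet of the left strand), left being relative to the upward direction. The genus-one morphism $\widehat\Phi:[\![D_-]\!]\to[\![D_+]\!]$ is the chain map equal to $\Phi$ on the summands with $\alpha(c_0)=0$ and to $0$ on the summands with $\alpha(c_0)=-1$. *)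

(* Defs.v *)
From HB Require Import structures.
From mathcomp Require Import all_boot all_order all_algebra fingroup perm.

Set Implicit Arguments.
Unset Strict Implicit.
Unset Printing Implicit Defensive.

Import Order.TTheory GRing.Theory Num.Theory.
Local Open Scope ring_scope.

Definition sym_rel (T : finType) (r : rel T) : rel T :=
  fun x y => r x y || r y x.

Lemma sym_rel_connect_sym (T : finType) (r : rel T) : connect_sym (sym_rel r).
Proof. by apply: sym_connect_sym => x y; rewrite /sym_rel orbC. Qed.

(* The quotient of T by the equivalence relation generated by r, each class
   being encoded by its canonical representative. *)
Definition pi0 (T : finType) (r : rel T) : finType :=
  {x : T | fingraph.roots (sym_rel r) x}.

Definition to_pi0 (T : finType) (r : rel T) (x : T) : pi0 r :=
  exist _ (fingraph.root (sym_rel r) x) (roots_root (sym_rel_connect_sym r) x).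

(* A closed oriented 1-manifold, cut into finitely many oriented arcs: the head
   of the arc x is glued to the tail of the arc arc_next x. *)
Record manifold := Manifold { arc_of : finType; arc_next : {perm arc_of} }.

Definition circles (W : manifold) : finType := pi0 (frel (arc_next W)).

Definition circle_of (W : manifold) (x : arc_of W) : circles W :=
  to_pi0 (frel (arc_next W)) x.

(* A compact oriented surface with boundary -W0 + W1, presented by gluing: take
   an oriented 2-sphere for each element of [sphere]; for each element t of
   [tube] remove two discs, from the spheres (ends t).1 and (ends t).2, and glue
   in an orientation-compatible tube (the two spheres may coincide); for each
   circle of W0 and of W1 remove a disc, from the sphere prescribed by [src] or
   [tgt], whose boundary is identified with that circle, orientations being
   respected.  All these discs are disjoint.  Every oriented cobordism arises
   in this way. *)
Record cobordism (W0 W1 : manifold) := Cobordism {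
  sphere : finType;
  tube : finType;
  ends : tube -> sphere * sphere;
  src : circles W0 -> sphere;
  tgt : circles W1 -> sphere }.

Arguments Cobordism {W0 W1} sphere tube ends src tgt.

Section Cobordisms.
Context {W0 W1 : manifold}.
Implicit Type S : cobordism W0 W1.

Definition tube_rel S : rel (sphere S) :=
  fun p q => [exists t, ends t == (p, q)].

Definition component S : finType := pi0 (@tube_rel S).

Definition component_of S (p : sphere S) : component S :=
  to_pi0 (@tube_rel S) p.

(* The first Betti number of the connected graph formed by the spheres and the
   tubes of the component (the truncated subtraction is exact). *)
Definition genus S (A : component S) : nat :=
  (#|[set t : tube S | component_of (ends t).1 == A]|.+1
   - #|[set p : sphere S | component_of p == A]|)%N.

(* Diffeomorphism rel boundary: by the classification of surfaces, oriented
   cobordisms between the same two 1-manifolds are diffeomorphic rel boundary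
   iff there is a genus-preserving bijection between their components which is
   compatible with the boundary circles. *)
Definition diffeomorphic S S' : Prop :=
  exists phi : component S -> component S',
    [/\ bijective phi,
        forall w, phi (component_of (src S w)) = component_of (src S' w),
        forall w, phi (component_of (tgt S w)) = component_of (tgt S' w)
      & forall A, genus (phi A) = genus A].

Definition add_tube S (p q : sphere S) : cobordism W0 W1 :=
  Cobordism (sphere S) (option (tube S))
    (fun t => if t is Some t' then ends t' else (p, q)) (@src _ _ S) (@tgt _ _ S).

Definition add_sphere S : cobordism W0 W1 :=
  Cobordism (option (sphere S)) (tube S)
    (fun t => (Some (ends t).1, Some (ends t).2))
    (fun w => Some (src S w)) (fun w => Some (tgt S w)).

End Cobordisms.

(* Joining a sheet to itself by a tube is the same as adding a handle to it. *)
Definition add_handle (W0 W1 : manifold) (S : cobordism W0 W1) (p : sphere S) :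
  cobordism W0 W1 := add_tube p p.

Definition add_torus (W0 W1 : manifold) (S : cobordism W0 W1) :
  cobordism W0 W1 := @add_handle _ _ (add_sphere S) None.

Definition cob_id (W : manifold) : cobordism W W :=
  Cobordism (circles W) void (of_void _) id id.

(* S2 after S1: each circle of W1 becomes a tube from S1 to S2. *)
Definition cob_comp (W0 W1 W2 : manifold)
    (S1 : cobordism W0 W1) (S2 : cobordism W1 W2) : cobordism W0 W2 :=
  Cobordism (sphere S1 + sphere S2)%type (tube S1 + tube S2 + circles W1)%type
    (fun t => match t with
      | inl (inl t1) => (inl (ends t1).1, inl (ends t1).2)
      | inl (inr t2) => (inr (ends t2).1, inr (ends t2).2)
      | inr w => (inl (tgt S1 w), inr (src S2 w))
      end)
    (fun w => inl (src S1 w)) (fun w => inr (tgt S2 w)).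

(* Formal linear combinations; they are compared with hom_eq below. *)
Definition cob_hom (k : comPzRingType) (W0 W1 : manifold) : Type :=
  seq (k * cobordism W0 W1).

(* The congruence presenting the k-module of morphisms: the constructors up to
   [hom_diffeo] present the free k-module on diffeomorphism classes, the last
   three are the relations (S), (T) and (4Tu). *)
Inductive hom_eq (k : comPzRingType) (W0 W1 : manifold) :
    cob_hom k W0 W1 -> cob_hom k W0 W1 -> Prop :=
| hom_refl f : hom_eq f f
| hom_sym f g : hom_eq f g -> hom_eq g f
| hom_trans f g h : hom_eq f g -> hom_eq g h -> hom_eq f h
| hom_cat f f' g g' : hom_eq f f' -> hom_eq g g' -> hom_eq (f ++ g) (f' ++ g')
| hom_catC f g : hom_eq (f ++ g) (g ++ f)
| hom_coef0 S : hom_eq [:: (0, S)] [::]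
| hom_coefD a b S : hom_eq [:: (a, S); (b, S)] [:: (a + b, S)]
| hom_diffeo a S S' : diffeomorphic S S' -> hom_eq [:: (a, S)] [:: (a, S')]
| hom_S a S : hom_eq [:: (a, add_sphere S)] [::]
| hom_T a S : hom_eq [:: (a, add_torus S)] [:: (a *+ 2, S)]
| hom_4Tu a S (p1 p2 p3 p4 : sphere S) :
    hom_eq [:: (a, add_tube p1 p2); (a, add_tube p3 p4)]
           [:: (a, add_tube p1 p3); (a, add_tube p2 p4)].

Definition hom_id (k : comPzRingType) (W : manifold) : cob_hom k W W :=
  [:: (1, cob_id W)].

(* g after f *)
Definition hom_comp (k : comPzRingType) (W0 W1 W2 : manifold)
    (f : cob_hom k W0 W1) (g : cob_hom k W1 W2) : cob_hom k W0 W2 :=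
  [seq (u.1 * v.1, cob_comp u.2 v.2) | u <- f, v <- g].

Record obj := Obj { summand : finType; ob : summand -> manifold }.

Definition mor (k : comPzRingType) (X Y : obj) : Type :=
  forall (i : summand X) (j : summand Y), cob_hom k (ob i) (ob j).

Definition mor_eq (k : comPzRingType) (X Y : obj) (f g : mor k X Y) : Prop :=
  forall i j, hom_eq (f i j) (g i j).

Definition mor_zero (k : comPzRingType) (X Y : obj) : mor k X Y :=
  fun i j => [::].

Definition mor_add (k : comPzRingType) (X Y : obj) (f g : mor k X Y) :
  mor k X Y := fun i j => f i j ++ g i j.

Definition mor_id (k : comPzRingType) (X : obj) : mor k X X :=
  fun i j => match i =P j with
    | ReflectT e => ecast j' (cob_hom k (ob i) (ob j')) e (hom_id k (ob i))
    | ReflectF _ => [::]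
    end.

(* g after f *)
Definition mor_comp (k : comPzRingType) (X Y Z : obj)
    (f : mor k X Y) (g : mor k Y Z) : mor k X Z :=
  fun i l => \big[cat/[::]]_(j : summand Y) hom_comp (f i j) (g j l).

(* Cohomologically graded objects with a degree one endomorphism; the equation
   d^2 = 0 is is_complex. *)
Record precomplex (k : comPzRingType) := Precomplex {
  cx : int -> obj;
  differential : forall n : int, mor k (cx n) (cx (n + 1)) }.

Arguments differential {k} p n.

Definition is_complex (k : comPzRingType) (C : precomplex k) : Prop :=
  forall n,
  mor_eq (mor_comp (differential C n) (differential C (n + 1))) (@mor_zero k _ _).

Definition graded_mor (k : comPzRingType) (C D : precomplex k) : Type :=
  forall n : int, mor k (cx C n) (cx D n).

Definition graded_id (k : comPzRingType) (C : precomplex k) :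
  graded_mor C C := fun n => @mor_id k (cx C n).

Arguments graded_id {k} C.

Definition graded_comp (k : comPzRingType) (C D E : precomplex k)
    (f : graded_mor C D) (g : graded_mor D E) : graded_mor C E :=
  fun n => mor_comp (f n) (g n).

Definition is_chain_map (k : comPzRingType) (C D : precomplex k)
    (f : graded_mor C D) : Prop :=
  forall n, mor_eq (mor_comp (f n) (differential D n))
                   (mor_comp (differential C n) (f (n + 1))).

(* f = g + d h + h d; h n is the component of the homotopy leaving degree n + 1,
   so the equation is stated in degree n + 1, for every integer n. *)
Definition homotopic (k : comPzRingType) (C D : precomplex k)
    (f g : graded_mor C D) : Prop :=
  exists h : forall n : int, mor k (cx C (n + 1)) (cx D n),
  forall n, mor_eq (f (n + 1))
    (mor_add (g (n + 1))
       (mor_add (mor_comp (h n) (differential D n))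
                (mor_comp (differential C (n + 1)) (h (n + 1))))).

Definition chain_homotopy_equivalence (k : comPzRingType) (C D : precomplex k)
    (f : graded_mor C D) : Prop :=
  [/\ is_complex C, is_complex D, is_chain_map f &
      exists g : graded_mor D C,
        [/\ is_chain_map g,
            homotopic (graded_comp f g) (graded_id C)
          & homotopic (graded_comp g f) (graded_id D)]].

(* Turn each crossing c so that its two strands point upward.  The pair (c, b)
   denotes the end of the strands on the left (b = false) or on the right
   (b = true) of c, among the outgoing ends NW, NE or among the incoming ends
   SW, SE; the strands are SW-NE and SE-NW.  The edge leaving c at the outgoing
   end x arrives at the incoming end glue x; edges are named by their outgoing
   end. *)
Definition strand_end (n : nat) : finType := ('I_n * bool)%type.

(* An edge can be run forward (o = true) or backwards (o = false).  The edge x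
   run in the direction o arrives at the end arrive glue o x, which is incoming
   if o holds and outgoing otherwise; the edge run in the direction o from the
   end z, outgoing if o holds and incoming otherwise, is depart glue o z. *)
Definition arrive (n : nat) (glue : {perm strand_end n}) (o : bool)
  (x : strand_end n) : strand_end n := if o then glue x else x.

Definition depart (n : nat) (glue : {perm strand_end n}) (o : bool)
  (z : strand_end n) : strand_end n := if o then z else (glue^-1)%g z.

(* The next directed edge along the boundary of the face on the left: at a
   crossing, one turns left, i.e. from SW to NW, from SE to SW, from NW to NE,
   and from NE to SE. *)
Definition face_next (n : nat) (glue : {perm strand_end n})
    (d : strand_end n * bool) : strand_end n * bool :=
  let: (x, o) := d in
  let: (c, b) := arrive glue o x in
  match o, b with
  | true, false => (depart glue true (c, false), true)
  | true, true => (depart glue false (c, false), false)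
  | false, false => (depart glue true (c, true), true)
  | false, true => (depart glue false (c, true), false)
  end.

Definition adjacent (n : nat) (glue : {perm strand_end n}) : rel 'I_n :=
  fun c c' => [exists b, (glue (c, b)).1 == c'].

(* Euler's formula V - E + F = 2 C with V = n vertices, E = 2 n edges, F faces
   and C connected components: each component embeds in the sphere. *)
Definition planar (n : nat) (glue : {perm strand_end n}) : Prop :=
  #|pi0 (frel (face_next glue))| = (n + 2 * #|pi0 (adjacent glue)|)%N.

(* An oriented link diagram with the signs of its crossings forgotten, together
   with a checkerboard coloring of its complement: nfree is the number of
   components without crossings, black e says whether the region on the left of
   the oriented edge e is black (the region on its right is then white).
   black_W and black_E say that both edges along the region W (resp. E) agree
   on the color of this region, and black_N that so do NW and NE for the
   region N. *)
Record shadow := Shadow {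
  ncross : nat;
  nfree : nat;
  glue : {perm strand_end ncross};
  black : strand_end ncross + 'I_nfree -> bool;
  glue_planar : planar glue;
  black_W : forall c,
    black (inl ((glue^-1)%g (c, false))) = black (inl (c, false));
  black_E : forall c,
    black (inl ((glue^-1)%g (c, true))) = black (inl (c, true));
  black_N : forall c, black (inl (c, true)) = ~~ black (inl (c, false)) }.

Definition crossing (P : shadow) : finType := 'I_(ncross P).

Definition edge (P : shadow) : finType :=
  (strand_end (ncross P) + 'I_(nfree P))%type.

(* The strands being oriented, the sign of a crossing determines which strand
   passes over.  The crossings are ordered as elements of 'I_(ncross P). *)
Record diagram := Diagram {
  diag_shadow :> shadow;
  positive : crossing diag_shadow -> bool }.

(* A state encodes an admissible alpha (see the function alpha): true
   stands for the horizontal smoothing, false for the vertical one. *)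
Definition state (P : shadow) : finType := {ffun crossing P -> bool}.

(* The edge following e in the smoothing s, when e is run in the direction o.
   A vertical arc joins ends of different kinds (one incoming, one outgoing) on
   the same side, a horizontal one ends of the same kind on different sides. *)
Definition step (P : shadow) (s : state P) (o : bool) (e : edge P) : edge P :=
  match e with
  | inl x =>
      let: (c, b) := arrive (glue P) o x in
      inl (if s c then depart (glue P) (~~ o) (c, ~~ b)
           else depart (glue P) o (c, b))
  | inr i => inr i
  end.

Lemma black_depart (P : shadow) (o : bool) (c : crossing P) (b : bool) :
  black (s := P) (inl (depart (glue P) o (c, b)))
  = black (s := P) (inl (c, false)) (+) b.
Proof.
case: o b => -[]; rewrite /depart ?black_W ?black_E ?black_N ?addbF //.
all: by rewrite addbT.
Qed.

Lemma arriveK (n : nat) (g : {perm strand_end n}) o :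
  cancel (arrive g o) (depart g (~~ o)).
Proof. by case: o => x /=; rewrite ?permK. Qed.

Lemma departK (n : nat) (g : {perm strand_end n}) o :
  cancel (depart g o) (arrive g (~~ o)).
Proof. by case: o => x /=; rewrite ?permKV. Qed.

Lemma step_black_inj (P : shadow) (s : state P) :
  injective (fun e => step s (black (s := P) e) e).
Proof.
apply: (can_inj (g := fun e => step s (~~ black (s := P) e) e)) => -[x|//].
set o := black (inl x); rewrite /step.
case Ey: (arrive (glue P) o x) => [c b].
have Ex : x = depart (glue P) (~~ o) (c, b) by rewrite -Ey arriveK.
have Eo : black (s := P) (inl (c, false)) (+) b = o.
  by rewrite /o Ex black_depart.
case: (boolP (s c)) => sc; rewrite black_depart ?addbN Eo ?negbK.
- by rewrite -[X in arrive _ X]negbK departK sc !negbK Ex.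
- by rewrite departK (negbTE sc) Ex.
Qed.

(* |D_alpha|: the smoothed diagram, each edge being oriented as the boundary of
   the black region, i.e. with the black region on its left. *)
Definition smoothing (P : shadow) (s : state P) : manifold :=
  @Manifold (edge P) (perm (@step_black_inj P s)).

Definition alpha (D : diagram) (s : state D) (c : crossing D) : int :=
  if s c then (if positive c then 1 else -1) else 0.

Definition weight (D : diagram) (s : state D) : int :=
  \sum_(c : crossing D) alpha s c.

(* For states s and t differing at one crossing, the trace of a single saddle
   move: its components are cylinders and one pair of pants, so they have genus
   zero and correspond to the classes of edges generated by the circles of both
   smoothings. *)
Definition saddle (P : shadow) (s t : state P) :
    cobordism (smoothing s) (smoothing t) :=
  let r : rel (edge P) := fun e f =>
    (arc_next (smoothing s) e == f) || (arc_next (smoothing t) e == f) in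
  Cobordism (pi0 r) void (of_void _)
    (fun w : circles (smoothing s) => to_pi0 r (val w))
    (fun w : circles (smoothing t) => to_pi0 r (val w)).

(* alpha t = alpha s + v *)
Definition raises (D : diagram) (s t : state D) (v : crossing D) : bool :=
  [forall c, alpha t c == alpha s c + (c == v)%:R].

Definition diff_coef (k : comPzRingType) (D : diagram) (s : state D)
    (v : crossing D) : k :=
  (-1) ^+ `|(\sum_(v' : crossing D | (v < v')%N) alpha s v')%R|%N
  * (if positive v then -1 else 1).

Definition khovanov_obj (D : diagram) (n : int) : obj :=
  @Obj {s : state D | weight s == n} (fun i => smoothing (val i)).

Definition khovanov (k : comPzRingType) (D : diagram) : precomplex k :=
  @Precomplex k (khovanov_obj D)
    (fun n i j => [seq (diff_coef k (val i) v, saddle (val i) (val j))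
                  | v <- enum (crossing D) & raises (val i) (val j) v]).

Definition left_strand (P : shadow) (s : state P) (c : crossing P) :
  circles (smoothing s) := @circle_of (smoothing s) (inl (c, false)).

Definition right_strand (P : shadow) (s : state P) (c : crossing P) :
  circles (smoothing s) := @circle_of (smoothing s) (inl (c, true)).

Definition Phi (k : comPzRingType) (P : shadow) (s : state P) (c : crossing P) :
    cob_hom k (smoothing s) (smoothing s) :=
  let I := cob_id (smoothing s) in
  [:: (1, @add_tube _ _ I (left_strand s c) (right_strand s c));
      (-1, @add_handle _ _ I (left_strand s c))].

(* neg and pos are the crossing signs of the diagrams D_- and D_+; the state s of
   either has alpha(c0) = 0 iff s c0 = false. *)
Definition genus_one (k : comPzRingType) (P : shadow)
    (neg pos : crossing P -> bool) (c0 : crossing P) :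
    graded_mor (khovanov k (Diagram neg)) (khovanov k (Diagram pos)) :=
  fun n i j => match val i =P val j with
    | ReflectT e =>
        if val i c0 then [::]
        else ecast t (cob_hom k (smoothing (val i)) (smoothing t)) e
               (Phi k (val i) c0)
    | ReflectF _ => [::]
    end.

Arguments genus_one {k P neg pos} c0 n i j.

(* The part D' of the diagram consists of the crossings c != c0 with
   side c = false, D'' of those with side c = true (crossingless components can
   be in either).  Every edge joins two ends of D' and of the left of c0, or two
   ends of D'' and of the right of c0. *)
Definition reducible (P : shadow) (c0 : crossing P) : Prop :=
  exists side : crossing P -> bool,
    let part (x : strand_end (ncross P)) :=
      if x.1 == c0 then x.2 else side x.1 in
    forall x, part (glue P x) = part x.

(* Main.v *)
Require Import Defs.
From HB Require Import structures.
From mathcomp Require Import all_boot all_order all_algebra fingroup perm.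
From mathcomp Require Import generic_quotient zify boolp.

(* Fix a state with c0 smoothed vertically and let L, R be the circles of the two
   strands, which differ because c0 is reducible.  Together with the state where
   c0 is smoothed horizontally, they give a sequence
     H --split--> V --Phi--> V --merge--> H
   which is contractible: the contraction V -> H caps L off, H -> V creates L,
   and V -> V does both (with a sign).  Indeed, at either V the two composites
   sum to the identity, by 4Tu applied to the disc on the incoming L, the disc on
   the outgoing L and the cylinder on R.  The contraction does not commute with
   the saddles at the other crossings, but the error raises the number of raised
   crossings other than c0, so it is nilpotent and the contraction can be
   corrected: the cone of the genus-one morphism is contractible.  The
   components of the contraction are the homotopy inverse and the homotopies. *)

Set Implicit Arguments.
Unset Strict Implicit.
Unset Printing Implicit Defensive.

Import Order.TTheory GRing.Theory Num.Theory.

(** * Counting the classes of a relation *)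

(** Both complexes are built on the same states and the same smoothed manifolds, so all maps, in all
    degrees at once, are elements of one ring: matrices over the states with classes of morphisms as
    entries. The cone is never formed; it survives as identities in this ring, and the two gradings
    enter only through the vanishing of entries in the wrong degree. On the side of surfaces the
    obstacle is genus, which does not add up under gluing, whereas the Euler characteristic does.
    Diffeomorphisms are therefore obtained by balancing spheres against tubes on arbitrary unions of
    components. For saddles this balance is a count of cycles: changing the smoothing at a crossing
    multiplies the successor permutation of the edges by a transposition, which splits one cycle or
    merges two. *)

Lemma big_optionE (R : Type) (idx : R) (op : Monoid.com_law idx) (I : finType)
    (F : option I -> R) :
  \big[op/idx]_x F x = op (F None) (\big[op/idx]_i F (Some i)).
Proof.
rewrite (bigD1 None) //=; congr (op _ _).
rewrite (reindex_omap Some id) //=; last by case.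
by apply: eq_bigl => i; rewrite eqxx.
Qed.

Section Connectivity.
Variables (T : finType) (r : rel T).

Definition conn : rel T := connect (sym_rel r).

Definition stable (S : Type) (q : T -> S) := forall x y, r x y -> q x = q y.

Lemma conn_refl x : conn x x. Proof. exact: connect0. Qed.

Lemma conn_sym x y : conn x y = conn y x.
Proof. exact: sym_rel_connect_sym. Qed.

Lemma conn_trans : transitive conn. Proof. exact: connect_trans. Qed.

Lemma conn1 x y : r x y -> conn x y.
Proof. by move=> rxy; apply: connect1; rewrite /sym_rel rxy. Qed.

Lemma conn_stable (S : Type) (q : T -> S) :
  stable q -> forall x y, conn x y -> q x = q y.
Proof.
move=> qr x _ /connectP[p rp ->].
elim: p x rp => //= z p IHp x /andP[rxz /IHp <-].
by case/orP: rxz => /qr.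
Qed.

Lemma to_pi0_eq x y : (to_pi0 r x == to_pi0 r y) = conn x y.
Proof. by rewrite -val_eqE /=; exact: root_connect (sym_rel_connect_sym r) x y. Qed.

Lemma to_pi0P x y : conn x y -> to_pi0 r x = to_pi0 r y.
Proof. by rewrite -to_pi0_eq => /eqP. Qed.

Lemma conn_val x : conn (val (to_pi0 r x)) x.
Proof. by rewrite conn_sym; exact: connect_root. Qed.

Lemma to_pi0_val (X : pi0 r) : to_pi0 r (val X) = X.
Proof. by apply: val_inj; case: X => x /= /eqP. Qed.

Lemma val_stable (S : Type) (q : T -> S) :
  stable q -> forall x, q (val (to_pi0 r x)) = q x.
Proof. by move=> qr x; apply: (conn_stable qr); apply: conn_val. Qed.

Lemma conn_is_stable x : stable (conn x).
Proof.
move=> y z /conn1 ryz; apply/idP/idP => [xy|xz]; first exact: conn_trans ryz.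
by apply: conn_trans xz _; rewrite conn_sym.
Qed.

(** For a stable [q] this is the number of classes on which [q] holds. Keeping [q] variable lets one
    identity of counts settle all unions of components. *)
Definition class_count (q : pred T) : nat := \sum_(X : pi0 r) q (val X).

Lemma class_count_conn x : class_count (conn x) = 1.
Proof.
rewrite /class_count (bigD1 (to_pi0 r x)) //= conn_sym conn_val big1 // => X.
by rewrite -{1}(to_pi0_val X) to_pi0_eq conn_sym => /negbTE->.
Qed.

End Connectivity.

Lemma conn_map (T T' : finType) (r : rel T) (r' : rel T') (f : T -> T') :
  (forall x y, r x y -> conn r' (f x) (f y)) ->
  forall x y, conn r x y -> conn r' (f x) (f y).
Proof.
move=> ff x y rxy; rewrite -(@conn_stable _ r _ (fun z => conn r' (f x) (f z)) _ _ _ rxy).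
  exact: conn_refl.
by move=> z t /ff; apply: (conn_stable (@conn_is_stable _ r' (f x))).
Qed.

Lemma conn_sub (T : finType) (r r' : rel T) :
  (forall x y, r x y -> conn r' x y) -> forall x y, conn r x y -> conn r' x y.
Proof. exact: (@conn_map _ _ r r' id). Qed.

Section AddPair.
Variables (T : finType) (r r' : rel T) (a b : T).
Hypotheses (rr' : forall x y, r x y -> conn r' x y) (ab : conn r' a b)
  (r'r : forall x y, r' x y -> conn r x y \/ (conn r x a /\ conn r y b) \/
                               (conn r x b /\ conn r y a)).

(** The hypotheses make [r'] generate the same equivalence as [r] and the pair [(a, b)], however
    [r'] is presented. A path needs to cross between the classes of [a] and [b] at most once, whence
    the three cases. *)
Lemma conn_add_pair x y : conn r' x y =
  conn r x y || (conn r x a && conn r y b) || (conn r x b && conn r y a).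
Proof.
apply/idP/idP; last first.
  case/orP => [/orP[xy|/andP[xa yb]]|/andP[xb ya]].
  - exact: conn_sub xy.
  - apply: conn_trans (conn_sub rr' xa) _; apply: conn_trans ab _.
    by rewrite conn_sym; exact: conn_sub yb.
  apply: conn_trans (conn_sub rr' xb) _; rewrite conn_sym.
  by apply: conn_trans (conn_sub rr' ya) _.
move=> xy; pose S z := conn r x z || (conn r x a && conn r z b) || (conn r x b && conn r z a).
rewrite -/(S y) -(@conn_stable _ r' _ S _ _ _ xy) /S ?conn_refl // => {S xy}y z.
have half u v : conn r u v \/ (conn r u a /\ conn r v b) \/ (conn r u b /\ conn r v a) ->
   conn r x u || (conn r x a && conn r u b) || (conn r x b && conn r u a) ->
   conn r x v || (conn r x a && conn r v b) || (conn r x b && conn r v a).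
  have tr s t w : conn r s t -> conn r s w -> conn r t w.
    by move=> st; apply: conn_trans; rewrite conn_sym.
  case=> [uv|[[ua vb]|[ub va]]].
  - case/orP => [/orP[xu|/andP[-> ub]]|/andP[-> ua]].
    + by rewrite (conn_trans xu uv).
    + by rewrite (tr _ _ _ uv ub) orbT.
    + by rewrite (tr _ _ _ uv ua) !orbT.
  - case/orP => [/orP[xu|/andP[xa ub]]|/andP[xb _]].
    + by rewrite (conn_trans xu ua) vb /= orbT.
    + by rewrite xa vb orbT.
    + by rewrite [conn r x v](conn_trans xb _) // conn_sym.
  - case/orP => [/orP[xu|/andP[xa _]]|/andP[xb _]].
    + by rewrite (conn_trans xu ub) va /= !orbT.
    + by rewrite [conn r x v](conn_trans xa _) // conn_sym.
    + by rewrite xb va !orbT.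
move=> /r'r yz; apply/idP/idP; apply: half => //.
case: yz => [yz|[[ya zb]|[yb za]]]; first by left; rewrite conn_sym.
  by right; right.
by right; left.
Qed.

(** Every class of [r'] is a single class of [r], except that of [a], which unites the classes of
    [a] and [b]. The sum is grouped by the fibres of the projection between the two sets of
    classes. *)
Lemma class_count_add_pair (q : pred T) : stable r' q ->
  class_count r q = class_count r' q + ~~ conn r a b * q a.
Proof.
move=> qr'; have q_conn x y : conn r' x y -> q x = q y by apply: conn_stable.
rewrite /class_count.
rewrite (partition_big (fun X : pi0 r => to_pi0 r' (val X)) predT) //=.
rewrite [X in _ = _ + X](_ : _ = \sum_(Y : pi0 r')
    (~~ conn r a b) * (q (val Y)) * (Y == to_pi0 r' a)); last first.
  rewrite (bigD1 (to_pi0 r' a)) //= eqxx muln1 big1 ?addn0; last first.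
    by move=> Y /negbTE->; rewrite muln0.
  by rewrite (q_conn _ a) // conn_val.
rewrite -big_split /=; apply: eq_bigr => Y _.
transitivity (\sum_(X : pi0 r | to_pi0 r' (val X) == Y) q (val Y)).
  apply: eq_bigr => X; rewrite -{1}(to_pi0_val Y) to_pi0_eq.
  by move=> /q_conn->.
rewrite sum_nat_const.
suff -> : #|[pred X : pi0 r | to_pi0 r' (val X) == Y]| =
    1 + ~~ conn r a b * (Y == to_pi0 r' a) by rewrite mulnDl mul1n mulnAC.
have EX X : (to_pi0 r' (val X) == Y) = (X == to_pi0 r (val Y))
    || (X == to_pi0 r a) && (to_pi0 r b == to_pi0 r (val Y))
    || (X == to_pi0 r b) && (to_pi0 r a == to_pi0 r (val Y)).
  rewrite -{1}(to_pi0_val Y) -{2 3 4}(to_pi0_val X) !to_pi0_eq conn_add_pair.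
  by rewrite ![conn r (val Y) _]conn_sym.
have EY : (Y == to_pi0 r' a) = (to_pi0 r (val Y) == to_pi0 r a)
     || (to_pi0 r (val Y) == to_pi0 r b).
  rewrite -{1}(to_pi0_val Y) !to_pi0_eq conn_add_pair conn_refl andbT.
  by do 2!case: (conn r (val Y) _) => //=.
rewrite -to_pi0_eq EY; move: (to_pi0 r (val Y)) (to_pi0 r a) (to_pi0 r b) EX => y a' b' EX.
have [eya|ny] := eqVneq y a'; last have [eyb|ny'] := eqVneq y b'; try subst y.
- rewrite muln1 add1n -cards2 -cardsE; apply: eq_card => X.
  by rewrite !inE EX eqxx andbT; case: (X == a').
- rewrite muln1 add1n -cards2 -cardsE; apply: eq_card => X.
  by rewrite !inE EX eqxx andbT orbC; case: (X == b'); rewrite ?orbT /= ?orbF.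
rewrite muln0 addn0 -(card1 y); apply: eq_card => X.
by rewrite !inE EX [b' == y]eq_sym [a' == y]eq_sym (negbTE ny) (negbTE ny') !andbF !orbF.
Qed.

End AddPair.

Lemma class_count_eq (T : finType) (r r' : rel T) (q : pred T) :
  (forall x y, r x y -> conn r' x y) -> (forall x y, r' x y -> conn r x y) ->
  stable r q -> class_count r q = class_count r' q.
Proof.
move=> rr' r'r qr; rewrite /class_count.
rewrite (reindex (fun X : pi0 r' => to_pi0 r (val X))) /=; last first.
  exists (fun X : pi0 r => to_pi0 r' (val X)) => X _.
    rewrite -{2}(to_pi0_val X); apply: to_pi0P; apply: (conn_sub rr').
    exact: conn_val.
  rewrite -{2}(to_pi0_val X); apply: to_pi0P; apply: (conn_sub r'r).
  exact: conn_val.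
by apply: eq_bigr => X _; rewrite (conn_stable qr (conn_val r (val X))).
Qed.

Definition join_rel (T : finType) (a b : T -> T) : rel T :=
  fun e f => (a e == f) || (b e == f).

(** * Multiplying a permutation by a transposition *)

Section Surgery.
Variables (T : finType) (a t : {perm T}) (x y : T).
Hypotheses (xy : x != y) (tE : forall e, t e = a (tperm x y e)).

Lemma conn_perm (s : {perm T}) e f : conn (frel s) e f = (e \in porbit s f).
Proof.
apply/idP/idP => [ef|].
  have: porbit s e = porbit s f.
    apply: (conn_stable _ ef) => u v /eqP <-; apply/esym.
    by have := porbit_perm s 1 u; rewrite expg1.
  by move=> <-; exact: porbit_id.
case/porbitP => i ->; elim: i => [|i IHi]; first by rewrite expg0 perm1 conn_refl.
apply: conn_trans IHi; rewrite conn_sym; apply: conn1.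
by rewrite expgSr permM /=.
Qed.

(** The formula for the number of cycles after multiplication by a transposition is applied from [a]
    to [t] and back. In the sum the numbers of cycles cancel, and exactly one of the two memberships
    must hold. *)
Lemma conn_surgery : conn (frel t) x y = ~~ conn (frel a) x y.
Proof.
have Et : t = (tperm x y * a)%g by apply/permP => e; rewrite permM.
have Ea : a = (tperm x y * t)%g by rewrite Et mulgA tperm2 mul1g.
rewrite !conn_perm.
have := porbits_mul_tperm t x y; have := porbits_mul_tperm a x y.
rewrite /= -Et -Ea xy; set m := #|_|; set n := #|_|.
case: (x \in _); case: (x \in _) => //= /eqP + /eqP; lia.
Qed.

Lemma surgeryC e : a e = t (tperm x y e).
Proof. by rewrite tE tpermK. Qed.
End Surgery.

Lemma class_count_cycles (T : finType) (a t : {perm T}) (x y : T) (q : pred T) :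
  x != y -> (forall e, t e = a (tperm x y e)) -> stable (join_rel a t) q ->
  class_count (frel a) q = class_count (join_rel a t) q + ~~ conn (frel a) x y * q x.
Proof.
move=> xy tE qinv; apply: class_count_add_pair => // [e f /= ef||e f].
- by apply: conn1; rewrite /join_rel ef.
- apply: (@conn_trans _ _ (a x)); first by apply: conn1; rewrite /join_rel eqxx.
  by rewrite conn_sym; apply: conn1; rewrite /join_rel tE tpermR eqxx orbT.
have ca z : conn (frel a) (a z) z by rewrite conn_sym conn1 //=.
case/orP => /eqP <-; first by left; rewrite conn_sym ca.
by rewrite tE; case: tpermP => [->|->|_ _]; rewrite ?ca ?conn_refl;
  [right; left | right; right | left; rewrite conn_sym ca].
Qed.

Lemma join_relC (T : finType) (a b : T -> T) : join_rel a b =2 join_rel b a.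
Proof. by move=> e f; rewrite /join_rel orbC. Qed.

(** Both sides count boundary circles of the trace of the surgery: each of its components is a
    cylinder with two of them, except the pair of pants at [x], which has three. *)
Lemma class_count_surgery (T : finType) (a t : {perm T}) (x y : T) (q : pred T) :
  x != y -> (forall e, t e = a (tperm x y e)) -> stable (join_rel a t) q ->
  class_count (frel a) q + class_count (frel t) q =
  2 * class_count (join_rel a t) q + q x.
Proof.
move=> xy tE qinv.
have qinv' : stable (join_rel t a) q by move=> e f; rewrite join_relC => /qinv.
rewrite (class_count_cycles xy tE) // (class_count_cycles xy (surgeryC tE)) //.
rewrite (conn_surgery xy tE).
rewrite (@class_count_eq _ (join_rel t a) (join_rel a t)) //.
- by case: (conn _ _ _); case: (q x) => /=; lia.
- by move=> e f; rewrite join_relC; exact: conn1.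
by move=> e f; rewrite join_relC; exact: conn1.
Qed.

(** * Sheets of a cobordism *)

Section Sheets.
Variables (W0 W1 : manifold).
Implicit Types S : cobordism W0 W1.

Definition sheet_conn S : rel (sphere S) := conn (@tube_rel _ _ S).

Definition spheres_in S (q : pred (sphere S)) : nat := \sum_p q p.

Definition tubes_in S (q : pred (sphere S)) : nat := \sum_t q (@ends _ _ S t).1.

Lemma sheet_conn_tube S (t : tube S) : sheet_conn (ends t).1 (ends t).2.
Proof. by apply: conn1; apply/existsP; exists t; rewrite -surjective_pairing. Qed.

Lemma tube_relP S (p q : sphere S) :
  reflect (exists t, ends t = (p, q)) (tube_rel p q).
Proof.
by apply: (iffP existsP) => -[t]; [move/eqP|move=> et]; exists t => //; apply/eqP.
Qed.

Lemma stable_tubes S (A : Type) (q : sphere S -> A) :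
  (forall t : tube S, q (ends t).1 = q (ends t).2) <-> stable (@tube_rel _ _ S) q.
Proof.
split=> [qt x y /tube_relP[t et]|qs t]; first by have := qt t; rewrite et.
by apply: qs; apply/tube_relP; exists t; rewrite -surjective_pairing.
Qed.

(** A graph has at most as many vertices as edges and components together. The list [l] lets the
    tubes be added one at a time, each lowering the number of classes by at most one. *)
Lemma spheres_in_le S (q : pred (sphere S)) : stable (@tube_rel _ _ S) q ->
  spheres_in q <= tubes_in q + class_count (@tube_rel _ _ S) q.
Proof.
move=> qs; pose R l := fun x y : sphere S => has (fun t => ends t == (x, y)) l.
suff Rq l : spheres_in q <= \sum_(t <- l) q (@ends _ _ S t).1 + class_count (R l) q.
  apply: leq_trans (Rq (enum (tube S))) _; rewrite /tubes_in big_enum /= leq_add2l.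
  have E x y : R (enum (tube S)) x y = tube_rel x y.
    apply/hasP/tube_relP => [[t _ /eqP]|[t et]]; first by exists t.
    by exists t; rewrite ?mem_enum // et.
  rewrite (@class_count_eq _ _ (@tube_rel _ _ S)) //.
  - by move=> x y; rewrite E; exact: conn1.
  - by move=> x y; rewrite -E; exact: conn1.
  by move=> x y; rewrite E; exact: qs.
elim: l => [|t l IHl].
  rewrite big_nil add0n /spheres_in (reindex (fun X : pi0 (R [::]) => val X)) //=.
  exists (to_pi0 (R [::])) => x _; first by rewrite to_pi0_val.
  exact: (@conn_stable _ _ _ id _ _ _ (conn_val (R [::]) x)).
apply: leq_trans IHl _; rewrite big_cons -addnA addnCA leq_add2l.
rewrite (@class_count_add_pair _ (R l) (R (t :: l)) (ends t).1 (ends t).2).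
- by rewrite addnC; case: (conn _ _ _); rewrite ?mul1n // leq_addl.
- by move=> x y lxy; apply: conn1; rewrite /R /= [has _ _]lxy orbT.
- by apply: conn1; rewrite /R /= -surjective_pairing eqxx.
- move=> x y /=; rewrite /R /= => /orP[/eqP->|lxy]; last by left; apply: conn1.
  by right; left; rewrite !conn_refl.
by move=> x y /hasP[u _ /eqP eu]; apply: qs; apply/tube_relP; exists u.
Qed.

Definition in_component S (A : component S) : pred (sphere S) :=
  fun p => component_of p == A.

Lemma in_component_stable S (A : component S) : stable (@tube_rel _ _ S) (in_component A).
Proof.
by move=> x y xy; rewrite /in_component /component_of (to_pi0P (conn1 xy)).
Qed.

Lemma card_sum (I : finType) (P : pred I) : #|[set x | P x]| = \sum_x P x.
Proof.
by rewrite -sum1dep_card big_mkcond; apply: eq_bigr => x _; case: (P x).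
Qed.

Lemma genusE S (A : component S) :
  genus A = (tubes_in (in_component A)).+1 - spheres_in (in_component A).
Proof. by rewrite /genus !card_sum. Qed.

(** The indicator of a component holds on exactly one class, so the truncated subtraction in [genus]
    loses nothing; equal genera then give equal Euler characteristics. *)
Lemma genus_exact S (A : component S) :
  spheres_in (in_component A) <= (tubes_in (in_component A)).+1.
Proof.
apply: leq_trans (spheres_in_le (@in_component_stable S A)) _.
suff -> : class_count (@tube_rel _ _ S) (in_component A) = 1 by rewrite addn1.
rewrite -(class_count_conn (@tube_rel _ _ S) (val A)); apply: eq_bigr => X _.
by rewrite /in_component -{1}(to_pi0_val A) to_pi0_eq conn_sym.
Qed.

Lemma sum_components S (I : finType) (h : I -> sphere S) (q : pred (sphere S)) :
  stable (@tube_rel _ _ S) q ->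
  \sum_i q (h i) = \sum_(A : component S) q (val A) * \sum_i in_component A (h i).
Proof.
move=> qs; under [RHS]eq_bigr do rewrite big_distrr /=.
rewrite exchange_big; apply: eq_bigr => i _ /=.
rewrite (bigD1 (component_of (h i))) //= big1 => [|A]; last first.
  by rewrite /in_component eq_sym => /negbTE->; rewrite muln0.
by rewrite /in_component eqxx muln1 addn0 (conn_stable qs (conn_val _ _)).
Qed.

Lemma stable_sheets S (A : Type) (q : sphere S -> A) x y :
  stable (@tube_rel _ _ S) q -> sheet_conn x y -> q x = q y.
Proof. by move=> qs; apply: conn_stable. Qed.

(* The last condition says that f preserves the Euler characteristic of every
   union of components, hence the genus of each one. *)
Definition sheet_equiv S S' (f : sphere S -> sphere S') (g : sphere S' -> sphere S) :=
  [/\ forall t : tube S, sheet_conn (f (ends t).1) (f (ends t).2),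
      forall t : tube S', sheet_conn (g (ends t).1) (g (ends t).2),
      forall p, sheet_conn (g (f p)) p & forall p, sheet_conn (f (g p)) p]
  /\ [/\ forall w, sheet_conn (f (src S w)) (src S' w),
      forall w, sheet_conn (f (tgt S w)) (tgt S' w)
    & forall q : pred (sphere S'), stable (@tube_rel _ _ S') q ->
      spheres_in (q \o f) + tubes_in q = spheres_in q + tubes_in (q \o f)].

(** The maps [f] and [g] may fail to be bijective on spheres; they are inverse to each other on
    components. With [q] the indicator of the image of a component, the balance of spheres and tubes
    becomes equality of genera. *)
Lemma sheet_equiv_diffeo S S' f g : @sheet_equiv S S' f g -> diffeomorphic S S'.
Proof.
case=> [[ft gt gf fg] [fs ftg fc]].
have fconn x y : sheet_conn x y -> sheet_conn (f x) (f y).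
  apply: conn_map => {}x {}y /tube_relP[t et]; have := ft t; by rewrite et.
have gconn x y : sheet_conn x y -> sheet_conn (g x) (g y).
  apply: conn_map => {}x {}y /tube_relP[t et]; have := gt t; by rewrite et.
have phiE p : component_of (f (val (component_of p))) = component_of (f p).
  by apply: to_pi0P; apply: fconn; apply: conn_val.
have psiE p : component_of (g (val (component_of p))) = component_of (g p).
  by apply: to_pi0P; apply: gconn; apply: conn_val.
have phiK : cancel (fun A : component S => component_of (f (val A)))
                   (fun A : component S' => component_of (g (val A))).
  by move=> A; rewrite psiE -{2}(to_pi0_val A); apply: to_pi0P; exact: gf.
have psiK : cancel (fun A : component S' => component_of (g (val A)))
                   (fun A : component S => component_of (f (val A))).
  by move=> A; rewrite phiE -{2}(to_pi0_val A); apply: to_pi0P; exact: fg.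
exists (fun A => component_of (f (val A))); split.
- by exists (fun A => component_of (g (val A))).
- by move=> w; rewrite phiE; apply: to_pi0P; exact: fs.
- by move=> w; rewrite phiE; apply: to_pi0P; exact: ftg.
move=> A; rewrite !genusE.
have := fc _ (@in_component_stable S' (component_of (f (val A)))).
have E p : in_component (component_of (f (val A))) (f p) = in_component A p.
  rewrite /in_component -phiE; apply: (can_eq phiK).
have -> : spheres_in (in_component (component_of (f (val A))) \o f) = spheres_in (in_component A).
  by apply: eq_bigr => p _; rewrite /= E.
have -> : tubes_in (in_component (component_of (f (val A))) \o f) = tubes_in (in_component A).
  by apply: eq_bigr => p _; rewrite /= E.
lia.
Qed.

(** Canonical representatives of components serve as [f] and [g]. The balance for [q] splits into a
    sum over components, where it follows from equality of genera and [genus_exact]. *)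
Lemma diffeo_sheet_equiv S S' : diffeomorphic S S' -> exists f g, @sheet_equiv S S' f g.
Proof.
case=> phi [[psi phiK psiK] phis phit phig].
have val_conn (S0 : cobordism W0 W1) (A : component S0) p :
   sheet_conn (val A) p = (A == component_of p).
  by rewrite -{2}(to_pi0_val A) to_pi0_eq.
exists (fun p => val (phi (component_of p))), (fun p => val (psi (component_of p))).
have compE (S0 : cobordism W0 W1) (t : tube S0) :
    component_of (ends t).1 = component_of (ends t).2.
  by apply: to_pi0P; apply: sheet_conn_tube.
have cval (S0 : cobordism W0 W1) (A : component S0) : component_of (val A) = A.
  exact: to_pi0_val.
do 2!split.
- by move=> t; rewrite compE; apply: conn_refl.
- by move=> t; rewrite compE; apply: conn_refl.
- by move=> p; rewrite val_conn cval phiK.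
- by move=> p; rewrite val_conn cval psiK.
- by move=> w; rewrite val_conn phis.
- by move=> w; rewrite val_conn phit.
move=> q qs; rewrite /spheres_in /tubes_in.
have qs' : stable (@tube_rel _ _ S) (q \o (fun p => val (phi (component_of p)))).
  by apply/stable_tubes => t /=; rewrite compE.
rewrite [X in X + _ = _](@sum_components S _ id) // [X in _ = _ + X](@sum_components S) //.
rewrite [X in _ + X = _](@sum_components S') // [X in _ = X + _](@sum_components S' _ id) //.
rewrite [X in _ + X = _](reindex phi) /=; last by exists psi => A _.
rewrite [X in _ = X + _](reindex phi) /=; last by exists psi => A _.
rewrite -!big_split /=; apply: eq_bigr => A _; rewrite cval.
have := phig A; have := genus_exact A; have := genus_exact (phi A).
rewrite !genusE /spheres_in /tubes_in -!mulnDr => ? ? ?; congr (_ * _); lia.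
Qed.

End Sheets.

(** * Composition up to diffeomorphism *)

Lemma sheet_conn_refl (W0 W1 : manifold) (S : cobordism W0 W1) (p : sphere S) : sheet_conn p p.
Proof. exact: conn_refl. Qed.

Lemma sheet_conn_trans (W0 W1 : manifold) (S : cobordism W0 W1) :
  transitive (@sheet_conn _ _ S).
Proof. exact: conn_trans. Qed.

Lemma sheet_conn_sym (W0 W1 : manifold) (S : cobordism W0 W1) (p q : sphere S) :
  sheet_conn p q = sheet_conn q p.
Proof. exact: conn_sym. Qed.

#[local] Hint Resolve sheet_conn_refl : core.

Lemma iso_diffeo (W0 W1 : manifold) (S S' : cobordism W0 W1)
    (f : sphere S -> sphere S') (g : sphere S' -> sphere S)
    (h : tube S -> tube S') (h' : tube S' -> tube S) :
  cancel f g -> cancel g f -> cancel h h' -> cancel h' h ->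
  (forall t, ends (h t) = (f (ends t).1, f (ends t).2)) ->
  (forall w, f (src S w) = src S' w) -> (forall w, f (tgt S w) = tgt S' w) ->
  diffeomorphic S S'.
Proof.
move=> fK gK hK h'K eh fs ft; apply: (@sheet_equiv_diffeo _ _ _ _ f g).
do 2!split.
- by move=> t; have := sheet_conn_tube (h t); rewrite eh.
- move=> t; have := sheet_conn_tube (h' t).
  by rewrite -{3 4}(h'K t) eh /= !fK.
- by move=> p; rewrite fK.
- by move=> p; rewrite gK.
- by move=> w; rewrite fs.
- by move=> w; rewrite ft.
move=> q _; rewrite /spheres_in /tubes_in; congr (_ + _).
  by rewrite [RHS](reindex f) //; exists g => x _.
rewrite [LHS](reindex h) /=; last by exists h' => x _.
by apply: eq_bigr => t _; rewrite eh.
Qed.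

Section Composition.
Variables (W0 W1 W2 : manifold).
Implicit Types (S : cobordism W0 W1) (T : cobordism W1 W2).

Lemma cob_comp_tube_l S T (t : tube S) :
  @sheet_conn _ _ (cob_comp S T) (inl (ends t).1) (inl (ends t).2).
Proof. exact: (@sheet_conn_tube _ _ (cob_comp S T) (inl (inl t))). Qed.

Lemma cob_comp_tube_r S T (t : tube T) :
  @sheet_conn _ _ (cob_comp S T) (inr (ends t).1) (inr (ends t).2).
Proof. exact: (@sheet_conn_tube _ _ (cob_comp S T) (inl (inr t))). Qed.

Lemma cob_comp_seam S T w : @sheet_conn _ _ (cob_comp S T) (inl (tgt S w)) (inr (src T w)).
Proof. exact: (@sheet_conn_tube _ _ (cob_comp S T) (inr w)). Qed.

Lemma sheet_conn_inl S T x y : sheet_conn x y -> @sheet_conn _ _ (cob_comp S T) (inl x) (inl y).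
Proof.
apply: (@conn_map _ _ (@tube_rel _ _ S) (@tube_rel _ _ (cob_comp S T)) inl).
by move=> {}x {}y /tube_relP[t et]; have := cob_comp_tube_l T t; rewrite et.
Qed.

Lemma sheet_conn_inr S T x y : sheet_conn x y -> @sheet_conn _ _ (cob_comp S T) (inr x) (inr y).
Proof.
apply: (@conn_map _ _ (@tube_rel _ _ T) (@tube_rel _ _ (cob_comp S T)) inr).
by move=> {}x {}y /tube_relP[t et]; have := cob_comp_tube_r S t; rewrite et.
Qed.

Lemma spheres_in_comp S T (q : pred (sphere (cob_comp S T))) :
  spheres_in q = spheres_in (fun p : sphere S => q (inl p)) +
    spheres_in (fun p : sphere T => q (inr p)).
Proof. by rewrite /spheres_in big_sumType. Qed.

Lemma tubes_in_comp S T (q : pred (sphere (cob_comp S T))) :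
  tubes_in q = tubes_in (fun p : sphere S => q (inl p)) + tubes_in (fun p : sphere T => q (inr p))
    + \sum_w q (inl (tgt S w)).
Proof. by rewrite /tubes_in big_sumType big_sumType. Qed.

Lemma stable_inl S T (A : Type) (q : sphere (cob_comp S T) -> A) :
  stable (@tube_rel _ _ (cob_comp S T)) q -> stable (@tube_rel _ _ S) (fun p => q (inl p)).
Proof. by move/stable_tubes=> qs; apply/stable_tubes => t; apply: (qs (inl (inl t))). Qed.

Lemma stable_inr S T (A : Type) (q : sphere (cob_comp S T) -> A) :
  stable (@tube_rel _ _ (cob_comp S T)) q -> stable (@tube_rel _ _ T) (fun p => q (inr p)).
Proof. by move/stable_tubes=> qs; apply/stable_tubes => t; apply: (qs (inl (inr t))). Qed.

Definition sum_map (A B C D : Type) (f : A -> C) (g : B -> D) (x : A + B) : C + D :=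
  match x with inl a => inl (f a) | inr b => inr (g b) end.

Lemma sum_rearrange a b c d a' b' c' d' e e' : a + b = c + d -> a' + b' = c' + d' ->
  e' = e -> a' + a + (b' + b + e) = c' + c + (d' + d + e').
Proof. lia. Qed.

(** Spheres and tubes add up under gluing, each seam contributing one tube, while the genus of a
    glued component depends on how the pieces meet. For this reason the invariance of composition
    goes through [sheet_equiv]. *)
Lemma cob_comp_equiv S S' T T' f g f' g' :
  @sheet_equiv _ _ S S' f g -> @sheet_equiv _ _ T T' f' g' ->
  @sheet_equiv _ _ (cob_comp S T) (cob_comp S' T') (sum_map f f') (sum_map g g').
Proof.
case=> [[ft gt gf fg] [fs fe fc]] [[ft' gt' gf' fg'] [fs' fe' fc']].
have gseam w : sheet_conn (g (tgt S' w)) (tgt S w).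
  apply: sheet_conn_trans (gf _); rewrite sheet_conn_sym.
  apply: (@conn_map _ _ (@tube_rel _ _ S') (@tube_rel _ _ S) g) (fe w).
  by move=> x y /tube_relP[t et]; have := gt t; rewrite et.
have gseam' w : sheet_conn (g' (src T' w)) (src T w).
  apply: sheet_conn_trans (gf' _); rewrite sheet_conn_sym.
  apply: (@conn_map _ _ (@tube_rel _ _ T') (@tube_rel _ _ T) g') (fs' w).
  by move=> x y /tube_relP[t et]; have := gt' t; rewrite et.
do 2!split.
- case=> [[t|t]|w] /=; [exact: sheet_conn_inl|exact: sheet_conn_inr|].
  apply: sheet_conn_trans (sheet_conn_inl T' (fe w)) _.
  apply: sheet_conn_trans (cob_comp_seam S' T' w) _.
  by rewrite sheet_conn_sym; apply: sheet_conn_inr.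
- case=> [[t|t]|w] /=; [exact: sheet_conn_inl|exact: sheet_conn_inr|].
  apply: sheet_conn_trans (sheet_conn_inl T (gseam w)) _.
  apply: sheet_conn_trans (cob_comp_seam S T w) _.
  by rewrite sheet_conn_sym; apply: sheet_conn_inr.
- by case=> p /=; [exact: sheet_conn_inl|exact: sheet_conn_inr].
- by case=> p /=; [exact: sheet_conn_inl|exact: sheet_conn_inr].
- by move=> w; apply: sheet_conn_inl.
- by move=> w; apply: sheet_conn_inr.
move=> q qs; rewrite !spheres_in_comp !tubes_in_comp.
have := fc _ (stable_inl qs); have := fc' _ (stable_inr qs); rewrite /comp /=.
move=> cT cS; apply: sum_rearrange cT cS _; apply: eq_bigr => w _.
by rewrite (stable_sheets (stable_inl qs) (fe w)).
Qed.

Lemma cob_comp_diffeo S S' T T' :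
  diffeomorphic S S' -> diffeomorphic T T' -> diffeomorphic (cob_comp S T) (cob_comp S' T').
Proof.
move=> /diffeo_sheet_equiv[f [g fg]] /diffeo_sheet_equiv[f' [g' fg']].
exact: sheet_equiv_diffeo (cob_comp_equiv fg fg').
Qed.

Lemma cob_comp_add_tube_l S T p q : diffeomorphic (cob_comp (@add_tube _ _ S p q) T)
  (@add_tube _ _ (cob_comp S T) (inl p) (inl q)).
Proof.
apply: (@iso_diffeo _ _ (cob_comp (@add_tube _ _ S p q) T)
  (@add_tube _ _ (cob_comp S T) (inl p) (inl q)) id id
  (fun t => match t with inl (inl None) => None | inl (inl (Some t)) => Some (inl (inl t))
            | inl (inr t) => Some (inl (inr t)) | inr w => Some (inr w) end)
  (fun t => match t with None => inl (inl None) | Some (inl (inl t)) => inl (inl (Some t))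
            | Some (inl (inr t)) => inl (inr t) | Some (inr w) => inr w end)) => //.
- by case=> [[[t|]|t]|t].
- by case=> [[[t|t]|w]|].
- by case=> [[[t|]|t]|t].
Qed.

Lemma cob_comp_add_tube_r S T p q : diffeomorphic (cob_comp S (@add_tube _ _ T p q))
  (@add_tube _ _ (cob_comp S T) (inr p) (inr q)).
Proof.
apply: (@iso_diffeo _ _ (cob_comp S (@add_tube _ _ T p q))
  (@add_tube _ _ (cob_comp S T) (inr p) (inr q)) id id
  (fun t => match t with inl (inr None) => None | inl (inr (Some t)) => Some (inl (inr t))
            | inl (inl t) => Some (inl (inl t)) | inr w => Some (inr w) end)
  (fun t => match t with None => inl (inr None) | Some (inl (inr t)) => inl (inr (Some t))
            | Some (inl (inl t)) => inl (inl t) | Some (inr w) => inr w end)) => //.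
- by case=> [[t|[t|]]|t].
- by case=> [[[t|t]|w]|].
- by case=> [[t|[t|]]|t].
Qed.

Let opt_l (A B : Type) (x : option A + B) : option (A + B) :=
  match x with inl (Some a) => Some (inl a) | inl None => None | inr b => Some (inr b) end.
Let opt_l' (A B : Type) (x : option (A + B)) : option A + B :=
  match x with Some (inl a) => inl (Some a) | None => inl None | Some (inr b) => inr b end.
Let opt_r (A B : Type) (x : A + option B) : option (A + B) :=
  match x with inr (Some a) => Some (inr a) | inr None => None | inl b => Some (inl b) end.
Let opt_r' (A B : Type) (x : option (A + B)) : A + option B :=
  match x with Some (inr a) => inr (Some a) | None => inr None | Some (inl b) => inl b end.

Lemma cob_comp_add_sphere_l S T :
  diffeomorphic (cob_comp (add_sphere S) T) (add_sphere (cob_comp S T)).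
Proof.
apply: (@iso_diffeo _ _ (cob_comp (add_sphere S) T) (add_sphere (cob_comp S T))
  (@opt_l _ _) (@opt_l' _ _) id id) => //.
- by case=> [[p|]|p].
- by case=> [[p|p]|].
- by case=> [[t|t]|w].
Qed.

Lemma cob_comp_add_sphere_r S T :
  diffeomorphic (cob_comp S (add_sphere T)) (add_sphere (cob_comp S T)).
Proof.
apply: (@iso_diffeo _ _ (cob_comp S (add_sphere T)) (add_sphere (cob_comp S T))
  (@opt_r _ _) (@opt_r' _ _) id id) => //.
- by case=> [p|[p|]].
- by case=> [[p|p]|].
- by case=> [[t|t]|w].
Qed.

Lemma cob_comp_add_torus_l S T :
  diffeomorphic (cob_comp (add_torus S) T) (add_torus (cob_comp S T)).
Proof.
apply: (@iso_diffeo _ _ (cob_comp (add_torus S) T) (add_torus (cob_comp S T))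
  (@opt_l _ _) (@opt_l' _ _)
  (fun t => match t with inl (inl None) => None | inl (inl (Some t)) => Some (inl (inl t))
            | inl (inr t) => Some (inl (inr t)) | inr w => Some (inr w) end)
  (fun t => match t with None => inl (inl None) | Some (inl (inl t)) => inl (inl (Some t))
            | Some (inl (inr t)) => inl (inr t) | Some (inr w) => inr w end)) => //.
- by case=> [[p|]|p].
- by case=> [[p|p]|].
- by case=> [[[t|]|t]|t].
- by case=> [[[t|t]|w]|].
- by case=> [[[t|]|t]|t].
Qed.

Lemma cob_comp_add_torus_r S T :
  diffeomorphic (cob_comp S (add_torus T)) (add_torus (cob_comp S T)).
Proof.
apply: (@iso_diffeo _ _ (cob_comp S (add_torus T)) (add_torus (cob_comp S T))
  (@opt_r _ _) (@opt_r' _ _)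
  (fun t => match t with inl (inr None) => None | inl (inr (Some t)) => Some (inl (inr t))
            | inl (inl t) => Some (inl (inl t)) | inr w => Some (inr w) end)
  (fun t => match t with None => inl (inr None) | Some (inl (inr t)) => inl (inr (Some t))
            | Some (inl (inl t)) => inl (inl t) | Some (inr w) => inr w end)) => //.
- by case=> [p|[p|]].
- by case=> [[p|p]|].
- by case=> [[t|[t|]]|t].
- by case=> [[[t|t]|w]|].
- by case=> [[t|[t|]]|t].
Qed.

End Composition.

Lemma cob_compA (W0 W1 W2 W3 : manifold) (S : cobordism W0 W1) (T : cobordism W1 W2)
    (U : cobordism W2 W3) :
  diffeomorphic (cob_comp S (cob_comp T U)) (cob_comp (cob_comp S T) U).
Proof.
apply: (@iso_diffeo _ _ (cob_comp S (cob_comp T U)) (cob_comp (cob_comp S T) U)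
  (fun x => match x with inl p => inl (inl p) | inr (inl p) => inl (inr p)
     | inr (inr p) => inr p end)
  (fun x => match x with inl (inl p) => inl p | inl (inr p) => inr (inl p)
     | inr p => inr (inr p) end)
  (fun t => match t with
     | inl (inl t) => inl (inl (inl (inl t))) | inl (inr (inl (inl t))) => inl (inl (inl (inr t)))
     | inl (inr (inl (inr t))) => inl (inr t) | inl (inr (inr w)) => inr w
     | inr w => inl (inl (inr w)) end)
  (fun t => match t with
     | inl (inl (inl (inl t))) => inl (inl t) | inl (inl (inl (inr t))) => inl (inr (inl (inl t)))
     | inl (inr t) => inl (inr (inl (inr t))) | inr w => inl (inr (inr w))
     | inl (inl (inr w)) => inr w end)) => //.
- by case=> [p|[p|p]].
- by case=> [[p|p]|p].
- by case=> [[t|[[t|t]|w]]|w].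
- by case=> [[[[t|t]|w]|t]|w].
- by case=> [[t|[[t|t]|w]]|w].
Qed.

Section Units.
Variables (W0 W1 : manifold) (S : cobordism W0 W1).

(** Each cylinder of the identity collapses onto the sheet behind its seam; the sphere and the tube
    that disappear cancel in the Euler characteristic. *)
Lemma cob_id_equiv_l : @sheet_equiv _ _ (cob_comp (cob_id W0) S) S
  (fun x => match x with inl w => src S w | inr p => p end) inr.
Proof.
do 2!split=> //.
- by case=> [[[]|t]|w] //=; exact: sheet_conn_tube.
- by move=> t; apply: cob_comp_tube_r.
- by case=> // w; rewrite sheet_conn_sym; apply: (@cob_comp_seam _ _ _ (cob_id W0) S w).
move=> q qs; rewrite spheres_in_comp tubes_in_comp.
by rewrite /spheres_in /tubes_in /= [X in _ = _ + (X + _ + _)]big_pred0; [lia|case].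
Qed.

Lemma cob_id_equiv_r : @sheet_equiv _ _ (cob_comp S (cob_id W1)) S
  (fun x => match x with inl p => p | inr w => tgt S w end) inl.
Proof.
do 2!split=> //.
- by case=> [[t|[]]|w] //=; exact: sheet_conn_tube.
- by move=> t; apply: cob_comp_tube_l.
- by case=> // w; apply: (@cob_comp_seam _ _ _ S (cob_id W1) w).
move=> q qs; rewrite spheres_in_comp tubes_in_comp.
by rewrite /spheres_in /tubes_in /= [X in _ = _ + (_ + X + _)]big_pred0; [lia|case].
Qed.

Lemma add_tube_sheet_conn (p q x y : sphere S) :
  sheet_conn x y -> @sheet_conn _ _ (@add_tube _ _ S p q) x y.
Proof.
apply: conn_sub => {}x {}y /tube_relP[t et].
by have := @sheet_conn_tube _ _ (@add_tube _ _ S p q) (Some t); rewrite /= et.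
Qed.

Lemma tubes_in_add_tube (p q : sphere S) (r : pred (sphere S)) :
  @tubes_in _ _ (@add_tube _ _ S p q) r = r p + tubes_in r.
Proof. by rewrite /tubes_in big_optionE. Qed.

End Units.

Lemma add_tube_equiv (W0 W1 : manifold) (S S' : cobordism W0 W1) f g p q p' q' :
  @sheet_equiv _ _ S S' f g -> sheet_conn (f p) p' -> sheet_conn (f q) q' ->
  @sheet_equiv _ _ (@add_tube _ _ S p q) (@add_tube _ _ S' p' q') f g.
Proof.
case=> [[ft gt gf fg] [fs fe fc]] fp fq.
have gconn x y : sheet_conn (f x) y -> sheet_conn (g y) x.
  move=> xy; apply: sheet_conn_trans (gf _); rewrite sheet_conn_sym.
  apply: (@conn_map _ _ (@tube_rel _ _ S') (@tube_rel _ _ S) g) xy.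
  by move=> {}x {}y /tube_relP[t et]; have := gt t; rewrite et.
do 2!split.
- case=> [t|] /=; first exact: add_tube_sheet_conn.
  apply: sheet_conn_trans (add_tube_sheet_conn _ _ fp) _.
  apply: sheet_conn_trans (@sheet_conn_tube _ _ (@add_tube _ _ S' p' q') None) _.
  by rewrite /= sheet_conn_sym; apply: add_tube_sheet_conn.
- case=> [t|] /=; first exact: add_tube_sheet_conn.
  apply: sheet_conn_trans (add_tube_sheet_conn _ _ (gconn _ _ fp)) _.
  apply: sheet_conn_trans (@sheet_conn_tube _ _ (@add_tube _ _ S p q) None) _.
  by rewrite /= sheet_conn_sym; apply: add_tube_sheet_conn; apply: gconn.
- by move=> x; apply: add_tube_sheet_conn; exact: gf.
- by move=> x; apply: add_tube_sheet_conn; exact: fg.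
- by move=> x; apply: add_tube_sheet_conn; exact: fs.
- by move=> x; apply: add_tube_sheet_conn; exact: fe.
move=> r rs; have rs' : stable (@tube_rel _ _ S') r.
  by apply/stable_tubes => t; apply: (proj2 (stable_tubes _) rs (Some t)).
rewrite !tubes_in_add_tube /= (stable_sheets rs' fp).
have := fc r rs'; rewrite /spheres_in /=; lia.
Qed.

Lemma sheet_equiv_refl (W0 W1 : manifold) (S : cobordism W0 W1) : @sheet_equiv _ _ S S id id.
Proof. by do 2!split => //; move=> t; apply: sheet_conn_tube. Qed.

(** * Traces of surgeries *)

(** [saddle s t] is convertible to the trace of the successor permutations of [s] and [t]; with
    arbitrary permutations the surfaces can be studied without a diagram. *)
Definition trace (T : finType) (a b : {perm T}) :
    cobordism (Manifold a) (Manifold b) :=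
  Cobordism (W0 := Manifold a) (W1 := Manifold b) (pi0 (join_rel a b)) void (of_void _)
    (fun w : circles (Manifold a) => to_pi0 (join_rel a b) (val w))
    (fun w : circles (Manifold b) => to_pi0 (join_rel a b) (val w)).

(** * Detaching a boundary circle *)

Section Cut.
Variables (W0 W1 : manifold) (S : cobordism W0 W1).

(* The circle w0 is detached from S and bounds a disc of its own. *)
Definition cut_src (w0 : circles W0) : cobordism W0 W1 :=
  Cobordism (option (sphere S)) (tube S) (fun t => (Some (ends t).1, Some (ends t).2))
    (fun w => if w == w0 then None else Some (src S w)) (fun w => Some (tgt S w)).

Definition cut_tgt (w0 : circles W1) : cobordism W0 W1 :=
  Cobordism (option (sphere S)) (tube S) (fun t => (Some (ends t).1, Some (ends t).2))
    (fun w => Some (src S w)) (fun w => if w == w0 then None else Some (tgt S w)).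

Lemma cut_tgt_conn (w0 : circles W1) (p q : sphere S) :
  sheet_conn p q -> @sheet_conn _ _ (cut_tgt w0) (Some p) (Some q).
Proof.
apply: (@conn_map _ _ (@tube_rel _ _ S) (@tube_rel _ _ (cut_tgt w0)) Some).
by move=> x y /tube_relP[t et]; have := @sheet_conn_tube _ _ (cut_tgt w0) t; rewrite /= et.
Qed.

(** The tube restores the collar that was cut. In this form the identity takes part in a 4Tu
    relation. *)
Lemma cut_tgt_tube (w0 : circles W1) :
  diffeomorphic S (@add_tube _ _ (cut_tgt w0) (Some (tgt S w0)) None).
Proof.
apply: (@sheet_equiv_diffeo _ _ S (@add_tube _ _ (cut_tgt w0) (Some (tgt S w0)) None)
  Some (fun x => if x is Some p then p else tgt S w0)).
have tc := @sheet_conn_tube _ _ (@add_tube _ _ (cut_tgt w0) (Some (tgt S w0)) None) None.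
do 2!split=> //.
- by move=> t; apply: add_tube_sheet_conn; apply: cut_tgt_conn; apply: sheet_conn_tube.
- by case=> [t|] //=; apply: sheet_conn_tube.
- by case.
- by move=> w /=; case: eqP => [->|].
move=> q qs; rewrite tubes_in_add_tube /spheres_in /tubes_in /= big_optionE /=.
by have /= -> := stable_sheets qs tc; lia.
Qed.

End Cut.

(** * Composites that start and end at the merged circle *)

Section SingleSaddle.
Variables (T : finType) (a t : {perm T}) (x y : T).
Hypotheses (xy : x != y) (tE : forall e, t e = a (tperm x y e)).

Lemma conn_trace_swap : conn (join_rel a t) x y.
Proof.
apply: (@conn_trans _ _ (a x)); first by apply: conn1; rewrite /join_rel eqxx.
by rewrite conn_sym; apply: conn1; rewrite /join_rel tE tpermR eqxx orbT.
Qed.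

Lemma conn_joinC e f : conn (join_rel t a) e f = conn (join_rel a t) e f.
Proof.
by apply/idP/idP; apply: conn_sub => u v; rewrite join_relC; exact: conn1.
Qed.

Lemma conn_joinl e f : conn (frel a) e f -> conn (join_rel a t) e f.
Proof. by apply: conn_sub => u v /= uv; apply: conn1; rewrite /join_rel uv. Qed.

Lemma conn_joinr e f : conn (frel t) e f -> conn (join_rel a t) e f.
Proof. by apply: conn_sub => u v /= uv; apply: conn1; rewrite /join_rel uv orbT. Qed.

Lemma class_count_joinC (q : pred T) : stable (join_rel a t) q ->
  class_count (join_rel t a) q = class_count (join_rel a t) q.
Proof.
move=> qs; apply: class_count_eq => [u v|u v|u v].
- by rewrite join_relC; exact: conn1.
- by rewrite join_relC; exact: conn1.
by rewrite join_relC; exact: qs.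
Qed.

Hypothesis axy : ~~ conn (frel a) x y.

(** Since [x] and [y] lie on different cycles of [a], they share a cycle of [t]. A step of [a] is a
    step of [t] up to exchanging [x] and [y], so it stays within a cycle of [t]. *)
Lemma conn_merge e f : conn (join_rel a t) e f -> conn (frel t) e f.
Proof.
have txy : conn (frel t) x y by rewrite (conn_surgery xy tE).
have tx z : conn (frel t) z (tperm x y z).
  by case: tpermP => [->|->|]; rewrite ?conn_refl // conn_sym.
apply: conn_sub => u v /orP[/eqP <-|uv]; last exact: conn1.
apply: conn_trans (tx u) _; apply: conn1.
by rewrite /= tE tpermK.
Qed.

Let L : circles (Manifold a) := to_pi0 (frel a) x.
Let R : circles (Manifold a) := to_pi0 (frel a) y.

Lemma merge_neq : (R == L) = false.
Proof. by rewrite eq_sym to_pi0_eq (negbTE axy). Qed.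

(** The cap closes the circle [L] that the split has created, which leaves cylinders. Every sheet is
    sent to the circle of [t] carrying its edges, and the balance is [class_count_surgery]. *)
Lemma cut_split_merge :
  diffeomorphic (cob_comp (trace t a) (cut_src (trace a t) L)) (cob_id (Manifold t)).
Proof.
pose r := join_rel a t; pose r' := join_rel t a.
pose S := cob_comp (trace t a) (cut_src (trace a t) L).
pose f (z : sphere S) : circles (Manifold t) := match z with
  | inl X => to_pi0 (frel t) (val X) | inr (Some X) => to_pi0 (frel t) (val X)
  | inr None => to_pi0 (frel t) x end.
pose g (w : circles (Manifold t)) : sphere S := inl (to_pi0 r' (val w)).
have fr e : to_pi0 (frel t) (val (to_pi0 r e)) = to_pi0 (frel t) e.
  by apply: to_pi0P; apply: conn_merge; apply: conn_val.
have fr' e : to_pi0 (frel t) (val (to_pi0 r' e)) = to_pi0 (frel t) e.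
  by apply: to_pi0P; apply: conn_merge; rewrite -conn_joinC; apply: conn_val.
have r't (X : pi0 r') : to_pi0 r' (val (to_pi0 (frel t) (val X))) = X.
  rewrite -[RHS]to_pi0_val; apply: to_pi0P; rewrite conn_joinC.
  exact: conn_joinr (conn_val _ _).
have seam := @cob_comp_seam _ _ _ (trace t a) (cut_src (trace a t) L).
apply: (@sheet_equiv_diffeo _ _ S (cob_id (Manifold t)) f g).
do 2!split=> //.
- case=> [[[]|[]]|w] /=; rewrite fr'; case: eqP => [->|_] /=; rewrite ?fr //.
  rewrite (@to_pi0P _ (frel t) (fingraph.root (sym_rel (frel a)) x) x) //.
  by apply: conn_merge; apply: conn_joinl; apply: conn_val.
- case=> [X|[X|]]; rewrite /f /g /= ?r't //.
  (* The sheet [X] is reached through a seam along a circle other than [L]. If the representative of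
     [X] lies on [L], the circle [R] does, since the saddle joins it to [L]. *)
  + have [w [wL wX]] : exists w : circles (Manifold a), w != L /\ to_pi0 r (val w) = X.
      case: (eqVneq (to_pi0 (frel a) (val X)) L) => [e|ne].
        exists R; rewrite merge_neq; split=> //.
        rewrite -[RHS]to_pi0_val; apply: to_pi0P.
        apply: conn_trans (conn_joinl (conn_val _ _)) _.
        rewrite conn_sym; apply: conn_trans conn_trace_swap; apply: conn_joinl.
        by rewrite -to_pi0_eq e.
      exists (to_pi0 (frel a) (val X)); split=> //.
      rewrite -[RHS]to_pi0_val; apply: to_pi0P; apply: conn_joinl.
      exact: conn_val.
    have := seam w; rewrite /= (negbTE wL) -/r wX; congr sheet_conn; congr inl.
    rewrite -wX; apply: to_pi0P; rewrite conn_joinC conn_sym.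
    apply: conn_trans (conn_joinr (conn_val _ _)) _; exact: conn_val.
  + have := seam L; rewrite /= eqxx; congr sheet_conn; congr inl.
    apply: to_pi0P; rewrite conn_joinC; apply: conn_trans (conn_joinl (conn_val _ _)) _.
    by rewrite conn_sym; apply: conn_joinr; apply: conn_val.
- by move=> w; rewrite /f /g fr' to_pi0_val.
- by move=> w; rewrite /f /= fr' to_pi0_val.
- by move=> w; rewrite /f /= fr to_pi0_val.
move=> q _; pose q' e := q (to_pi0 (frel t) e).
have qs : stable r q'.
  by move=> u v uv; rewrite /q' (to_pi0P (conn_merge (conn1 uv))).
rewrite spheres_in_comp tubes_in_comp.
have -> : spheres_in (fun p => (q \o f) (inl p)) = class_count r' q' by [].
have -> : spheres_in (fun p => (q \o f) (inr p)) = q' x + class_count r q'.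
  by rewrite /spheres_in big_optionE.
have -> : @spheres_in _ _ (cob_id (Manifold t)) q = class_count (frel t) q'.
  by apply: eq_bigr => w _; rewrite /q' to_pi0_val.
have -> : \sum_w (q \o f) (inl (tgt (trace t a) w)) = class_count (frel a) q'.
  by apply: eq_bigr => w _; rewrite /= fr'.
rewrite /tubes_in !big_pred0; [|by case..].
have := class_count_surgery xy tE qs; rewrite class_count_joinC // -/r; lia.
Qed.

Lemma split_cut_merge :
  diffeomorphic (cob_comp (cut_tgt (trace t a) L) (trace a t)) (cob_id (Manifold t)).
Proof.
pose r := join_rel a t; pose r' := join_rel t a.
pose S := cob_comp (cut_tgt (trace t a) L) (trace a t).
pose f (z : sphere S) : circles (Manifold t) := match z with
  | inr X => to_pi0 (frel t) (val X) | inl (Some X) => to_pi0 (frel t) (val X)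
  | inl None => to_pi0 (frel t) x end.
pose g (w : circles (Manifold t)) : sphere S := inr (to_pi0 r (val w)).
have fr e : to_pi0 (frel t) (val (to_pi0 r e)) = to_pi0 (frel t) e.
  by apply: to_pi0P; apply: conn_merge; apply: conn_val.
have fr' e : to_pi0 (frel t) (val (to_pi0 r' e)) = to_pi0 (frel t) e.
  by apply: to_pi0P; apply: conn_merge; rewrite -conn_joinC; apply: conn_val.
have rt (X : pi0 r) : to_pi0 r (val (to_pi0 (frel t) (val X))) = X.
  rewrite -[RHS]to_pi0_val; apply: to_pi0P.
  exact: conn_joinr (conn_val _ _).
have seam := @cob_comp_seam _ _ _ (cut_tgt (trace t a) L) (trace a t).
apply: (@sheet_equiv_diffeo _ _ S (cob_id (Manifold t)) f g).
do 2!split=> //.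
- case=> [[[]|[]]|w] /=; rewrite fr; case: eqP => [->|_] /=; rewrite ?fr' //.
  rewrite (@to_pi0P _ (frel t) (fingraph.root (sym_rel (frel a)) x) x) //.
  by apply: conn_merge; apply: conn_joinl; apply: conn_val.
- case=> [[X|]|X]; rewrite /f /g /= ?rt //.
  + have [w [wL wX]] : exists w : circles (Manifold a), w != L /\ to_pi0 r' (val w) = X.
      case: (eqVneq (to_pi0 (frel a) (val X)) L) => [e|ne].
        exists R; rewrite merge_neq; split=> //.
        rewrite -[RHS]to_pi0_val; apply: to_pi0P; rewrite conn_joinC.
        apply: conn_trans (conn_joinl (conn_val _ _)) _.
        rewrite conn_sym; apply: conn_trans conn_trace_swap; apply: conn_joinl.
        by rewrite -to_pi0_eq e.
      exists (to_pi0 (frel a) (val X)); split=> //.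
      rewrite -[RHS]to_pi0_val; apply: to_pi0P; rewrite conn_joinC; apply: conn_joinl.
      exact: conn_val.
    rewrite sheet_conn_sym.
    have := seam w; rewrite /= (negbTE wL) -/r' wX; congr sheet_conn; congr inr.
    rewrite -wX; apply: to_pi0P; rewrite conn_sym.
    apply: conn_trans (conn_joinr (conn_val _ _)) _; rewrite -conn_joinC; exact: conn_val.
  + rewrite sheet_conn_sym.
    have := seam L; rewrite /= eqxx; congr sheet_conn; congr inr.
    apply: to_pi0P; apply: conn_trans (conn_joinl (conn_val _ _)) _.
    by rewrite conn_sym; apply: conn_joinr; apply: conn_val.
- by move=> w; rewrite /f /g fr to_pi0_val.
- by move=> w; rewrite /f /= fr' to_pi0_val.
- by move=> w; rewrite /f /= fr to_pi0_val.
move=> q _; pose q' e := q (to_pi0 (frel t) e).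
have qs : stable r q'.
  by move=> u v uv; rewrite /q' (to_pi0P (conn_merge (conn1 uv))).
rewrite spheres_in_comp tubes_in_comp.
have -> : spheres_in (fun p => (q \o f) (inr p)) = class_count r q' by [].
have -> : spheres_in (fun p => (q \o f) (inl p)) = q' x + class_count r' q'.
  by rewrite /spheres_in big_optionE.
have -> : @spheres_in _ _ (cob_id (Manifold t)) q = class_count (frel t) q'.
  by apply: eq_bigr => w _; rewrite /q' to_pi0_val.
have -> : \sum_w (q \o f) (inl (tgt (cut_tgt (trace t a) L) w)) = class_count (frel a) q'.
  apply: eq_bigr => w _ /=; case: eqP => [->|]; rewrite /= ?fr' // /q'.
  by congr (nat_of_bool (q _)); apply: to_pi0P; apply: conn_merge; apply: conn_joinl;
     rewrite conn_sym; apply: conn_val.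
rewrite /tubes_in !big_pred0; [|by case..].
have := class_count_surgery xy tE qs; rewrite class_count_joinC // -/r; lia.
Qed.

End SingleSaddle.

(** * Composites that pass through the merged circle *)

Section MergeFirst.
Variables (T : finType) (a t : {perm T}) (x y : T).
Hypotheses (xy : x != y) (tE : forall e, t e = a (tperm x y e)).
Hypothesis axy : ~~ conn (frel a) x y.

Let L : circles (Manifold a) := to_pi0 (frel a) x.
Let R : circles (Manifold a) := to_pi0 (frel a) y.
Let I := cut_tgt (cob_id (Manifold a)) L.

Let r := join_rel a t.
Let r' := join_rel t a.
(** A merge puts [L] and [R] on one sheet, so a map from its sheets must treat them alike: both go
    to [R]. This leaves [Some L] and [None] free to be the two discs on [L]. *)
Let h (e : T) : sphere I := let w := to_pi0 (frel a) e in Some (if w == L then R else w).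

Let RL : (R == L) = false. Proof. exact: merge_neq axy. Qed.

Let h_conn e e' : conn r e e' -> h e = h e'.
Proof.
rewrite /h; rewrite (@conn_add_pair _ (frel a) r x y); last first.
- move=> u v; have ca z : conn (frel a) (a z) z by rewrite conn_sym conn1 //=.
  case/orP => /eqP <-; first by left; rewrite conn_sym ca.
  by rewrite tE; case: tpermP => [->|->|_ _]; rewrite ?ca ?conn_refl;
    [right; left | right; right | left; rewrite conn_sym ca].
- exact: conn_trace_swap.
- by move=> u v uv; apply: conn1; rewrite /r /join_rel; move: uv => /= ->.
rewrite -!to_pi0_eq -/L -/R => /orP[/orP[/eqP->|/andP[/eqP-> /eqP->]]|/andP[/eqP-> /eqP->]] //.
all: by rewrite eqxx RL.
Qed.

Let h_join u : h (val (to_pi0 r u)) = h u.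
Proof. by apply: h_conn; apply: conn_val. Qed.

Let h_join' u : h (val (to_pi0 r' u)) = h u.
Proof. by apply: h_conn; rewrite -conn_joinC; apply: conn_val. Qed.

Let h_circle (w : circles (Manifold a)) : h (val w) = Some (if w == L then R else w).
Proof. by rewrite /h to_pi0_val. Qed.

Let hx : h x = Some R. Proof. by rewrite /h eqxx. Qed.

Let h_root e : conn r (val (if to_pi0 (frel a) e == L then R else to_pi0 (frel a) e)) e.
Proof.
case: eqP => [eL|_]; last by apply: conn_joinl; apply: conn_val.
apply: conn_trans (conn_joinl _ (conn_val _ _)) _; rewrite conn_sym.
apply: conn_trans (conn_trace_swap tE); apply: conn_joinl.
by rewrite -to_pi0_eq eL.
Qed.

(** Among the sheets of [I], [h] reaches [R] from two circles and misses the discs [Some L] and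
    [None], hence the three correction terms. *)
Let sum_h (q : pred (sphere I)) :
  spheres_in q + q (Some R) = q None + class_count (frel a) (q \o h) + q (Some L).
Proof.
have -> : class_count (frel a) (q \o h) = \sum_w q (Some (if w == L then R else w)).
  by apply: eq_bigr => w _; rewrite /= h_circle.
rewrite /spheres_in big_optionE (bigD1 L) // [X in _ = _ + X + _](bigD1 L) // eqxx.
rewrite [X in _ = _ + (_ + X) + _](eq_bigr (fun w => q (Some w) : nat)).
  have ar (n l s m : nat) : n + (l + s) + m = n + (m + s) + l by lia.
  exact: ar.
by move=> w /negbTE->.
Qed.

Let tubes_I (q : pred (sphere I)) : tubes_in q = 0.
Proof. by rewrite /tubes_in big_pred0 //; case. Qed.

Let count_h (q : pred (sphere I)) :
  class_count (frel a) (q \o h) + class_count (frel t) (q \o h) =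
    2 * class_count r (q \o h) + q (Some R)
  /\ class_count r' (q \o h) = class_count r (q \o h).
Proof.
have qs : stable r (q \o h) by move=> u v /conn1 /h_conn /= ->.
split; last exact: class_count_joinC.
by rewrite (class_count_surgery xy tE qs) /= hx.
Qed.

(** Once the incoming [L] is capped, the cylinder on [R] splits off the outgoing [L]: the disc
    [Some L] stays alone and [None] is tubed to [R]. *)
Lemma cut_merge_split : diffeomorphic
  (cob_comp (cut_src (trace a t) L) (trace t a)) (@add_tube _ _ I None (Some R)).
Proof.
pose S := cob_comp (cut_src (trace a t) L) (trace t a).
pose S' := @add_tube _ _ I None (Some R).
pose f (z : sphere S) : sphere S' := match z with
  | inl None => Some L | inl (Some X) => h (val X) | inr X => h (val X) end.
pose g (z : sphere S') : sphere S := match z with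
  | Some w => if w == L then inl None else inl (Some (to_pi0 r (val w)))
  | None => inr (to_pi0 r' x) end.
have seam e : @sheet_conn _ _ S (inl (Some (to_pi0 r e))) (inr (to_pi0 r' e)).
  have -> : to_pi0 r e = to_pi0 r (val (to_pi0 (frel t) e)).
    by apply: to_pi0P; rewrite conn_sym; apply: conn_joinr; apply: conn_val.
  have -> : to_pi0 r' e = to_pi0 r' (val (to_pi0 (frel t) e)).
    by apply: to_pi0P; rewrite conn_joinC conn_sym; apply: conn_joinr; apply: conn_val.
  exact: (@cob_comp_seam _ _ _ (cut_src (trace a t) L) (trace t a) (to_pi0 (frel t) e)).
have gh e : g (h e) = inl (Some (to_pi0 r e)).
  rewrite /g /h (_ : (_ == L) = false); last by case: ifP.
  by congr (inl (Some _)); apply: to_pi0P; apply: h_root.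
have tc : @sheet_conn _ _ S' None (Some R) := @sheet_conn_tube _ _ S' None.
have fg p : sheet_conn (f (g p)) p.
  case: p => [w|] /=; last by rewrite h_join' hx sheet_conn_sym.
  by case: eqP => [->//|/eqP wL] /=; rewrite h_join h_circle (negbTE wL).
apply: (@sheet_equiv_diffeo _ _ S S' f g); do 2!split.
- by case=> [[[]|[]]|w]; rewrite /f /= h_join h_join'.
- case=> [[]|]; rewrite /g /= RL.
  rewrite sheet_conn_sym; have := h_root x; rewrite eqxx => /to_pi0P /= ->.
  exact: seam.
- case=> [[X|]|X]; last 1 first.
  + by rewrite -[f _]/(h (val X)) gh -{2}(to_pi0_val X); apply: seam.
  + by rewrite -[f _]/(h (val X)) gh to_pi0_val.
  by rewrite /= eqxx.
- exact: fg.
- by move=> w; have := fg (Some w); rewrite /=; case: eqP.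
- by move=> w; rewrite /= h_join' h_circle; case: eqP => // _; rewrite sheet_conn_sym.
move=> q qs; have tq := stable_sheets qs tc.
rewrite spheres_in_comp tubes_in_comp tubes_in_add_tube tubes_I.
have -> : spheres_in (fun p => (q \o f) (inl p)) = q (Some L) + class_count r (q \o h).
  by rewrite /spheres_in big_optionE.
have -> : spheres_in (fun p => (q \o f) (inr p)) = class_count r' (q \o h) by [].
have -> : \sum_w (q \o f) (inl (tgt (cut_src (trace a t) L) w)) = class_count (frel t) (q \o h).
  by apply: eq_bigr => w _; rewrite /= h_join.
rewrite /tubes_in !big_pred0; [|by case..].
have ar s na nt nr nr' ql qr qn : s + qr = qn + na + ql -> na + nt = 2 * nr + qr ->
  nr' = nr -> qn = qr -> ql + nr + nr' + (qn + 0) = s + (0 + 0 + nt) by lia.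
by have [ca ct] := count_h q; apply: ar (sum_h q) ca ct (congr1 _ tq).
Qed.

(** Here the incoming [L] merges into [R] and the outgoing [L] is born afterwards, so [Some L] is
    tubed to [R] and [None] stays alone. *)
Lemma merge_split_cut : diffeomorphic
  (cob_comp (trace a t) (cut_tgt (trace t a) L)) (@add_tube _ _ I (Some L) (Some R)).
Proof.
pose S := cob_comp (trace a t) (cut_tgt (trace t a) L).
pose S' := @add_tube _ _ I (Some L) (Some R).
pose f (z : sphere S) : sphere S' := match z with
  | inr None => None | inr (Some X) => h (val X) | inl X => h (val X) end.
pose g (z : sphere S') : sphere S := match z with
  | Some w => inl (to_pi0 r (val w)) | None => inr None end.
have seam e : @sheet_conn _ _ S (inl (to_pi0 r e)) (inr (Some (to_pi0 r' e))).
  have -> : to_pi0 r e = to_pi0 r (val (to_pi0 (frel t) e)).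
    by apply: to_pi0P; rewrite conn_sym; apply: conn_joinr; apply: conn_val.
  have -> : to_pi0 r' e = to_pi0 r' (val (to_pi0 (frel t) e)).
    by apply: to_pi0P; rewrite conn_joinC conn_sym; apply: conn_joinr; apply: conn_val.
  exact: (@cob_comp_seam _ _ _ (trace a t) (cut_tgt (trace t a) L) (to_pi0 (frel t) e)).
have gh e : g (h e) = inl (to_pi0 r e).
  by congr inl; apply: to_pi0P; apply: h_root.
have tc : @sheet_conn _ _ S' (Some L) (Some R) := @sheet_conn_tube _ _ S' None.
have fg p : sheet_conn (f (g p)) p.
  case: p => [w|] //=; rewrite h_join h_circle.
  by case: eqP => // ->; rewrite sheet_conn_sym.
apply: (@sheet_equiv_diffeo _ _ S S' f g); do 2!split.
- by case=> [[[]|[]]|w]; rewrite /f /= h_join h_join'.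
- case=> [[]|]; rewrite /g /=.
  rewrite (@to_pi0P _ r (val L) (val R)) //.
  apply: conn_trans (conn_joinl _ (conn_val _ _)) _.
  apply: conn_trans (conn_trace_swap tE) _.
  by rewrite conn_sym; apply: conn_joinl; apply: conn_val.
- case=> [X|[X|]] //.
  + by rewrite -[f _]/(h (val X)) gh to_pi0_val.
  by rewrite -[f _]/(h (val X)) gh -{2}(to_pi0_val X); apply: seam.
- exact: fg.
- by move=> w; apply: fg (Some w).
- by move=> w; rewrite /=; case: eqP => //= wL; rewrite h_join' h_circle; case: eqP.
move=> q qs; have tq := stable_sheets qs tc.
rewrite spheres_in_comp tubes_in_comp tubes_in_add_tube tubes_I.
have -> : spheres_in (fun p => (q \o f) (inr p)) = q None + class_count r' (q \o h).
  by rewrite /spheres_in big_optionE.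
have -> : spheres_in (fun p => (q \o f) (inl p)) = class_count r (q \o h) by [].
have -> : \sum_w (q \o f) (inl (tgt (trace a t) w)) = class_count (frel t) (q \o h).
  by apply: eq_bigr => w _; rewrite /= h_join.
rewrite /tubes_in !big_pred0; [|by case..].
have ar s na nt nr nr' ql qr qn : s + qr = qn + na + ql -> na + nt = 2 * nr + qr ->
  nr' = nr -> ql = qr -> nr + (qn + nr') + (ql + 0) = s + (0 + 0 + nt) by lia.
by have [ca ct] := count_h q; apply: ar (sum_h q) ca ct (congr1 _ tq).
Qed.

End MergeFirst.

(** * Surgeries at disjoint places commute *)

Section TwoSaddles.
Variables (T : finType) (a b b' c : {perm T}).
Hypothesis bP' : forall e, b' e = a e \/ b' e = c e.

Lemma two_traces_conn (q : T -> sphere (cob_comp (trace a b) (trace b c))) :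
  (forall e, @sheet_conn _ _ (cob_comp (trace a b) (trace b c)) (q e) (inl (to_pi0 _ e))) ->
  [/\ forall e f, conn (join_rel a b) e f -> sheet_conn (q e) (q f),
      forall e f, conn (join_rel b c) e f -> sheet_conn (q e) (q f),
      forall e f, conn (join_rel a b') e f -> sheet_conn (q e) (q f),
      forall e f, conn (join_rel b' c) e f -> sheet_conn (q e) (q f)
    & forall e, sheet_conn (q e) (inr (to_pi0 _ e))].
Proof.
move=> qE; pose S := cob_comp (trace a b) (trace b c).
have qE' e : @sheet_conn _ _ S (q e) (inr (to_pi0 _ e)).
  apply: sheet_conn_trans (qE e) _.
  have := @cob_comp_seam _ _ _ (trace a b) (trace b c) (to_pi0 (frel b) e).
  by congr sheet_conn; [congr inl | congr inr]; apply: to_pi0P;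
     [apply: conn_joinr | apply: conn_joinl]; apply: conn_val.
have qa e : sheet_conn (q e) (q (a e)).
  apply: sheet_conn_trans (qE e) _; rewrite sheet_conn_sym.
  rewrite (@to_pi0P _ _ e (a e)) //; apply: conn1; by rewrite /join_rel eqxx.
have qb e : sheet_conn (q e) (q (b e)).
  apply: sheet_conn_trans (qE e) _; rewrite sheet_conn_sym.
  rewrite (@to_pi0P _ _ e (b e)) //; apply: conn1; by rewrite /join_rel eqxx orbT.
have qc e : sheet_conn (q e) (q (c e)).
  apply: sheet_conn_trans (qE' e) _; rewrite sheet_conn_sym.
  rewrite (@to_pi0P _ _ e (c e)) //; apply: conn1; by rewrite /join_rel eqxx orbT.
have qb' e : sheet_conn (q e) (q (b' e)) by case: (bP' e) => ->.
have lift (d d' : {perm T}) : (forall e, sheet_conn (q e) (q (d e))) ->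
    (forall e, sheet_conn (q e) (q (d' e))) ->
    forall e f, conn (join_rel d d') e f -> sheet_conn (q e) (q f).
  by move=> qd qd'; apply: conn_map => u v /orP[] /eqP <-; [exact: qd | exact: qd'].
by split=> //; apply: lift.
Qed.
End TwoSaddles.

(** Every step of [b] or [b'] is a step of [a] or of [c], so in both orders the components are the
    classes of edges generated by [a] and [c]. By [class_count_surgery] at both stages, twice the
    number of spheres minus tubes in [q] equals the cycles of [a] and of [c] in [q], minus [q x] and
    [q x'], whatever the intermediate permutation. *)
Lemma two_traces_diffeo (T : finType) (a b b' c : {perm T}) (x y x' y' : T) :
  x != y -> x' != y' ->
  (forall e, b e = a (tperm x y e)) -> (forall e, c e = b (tperm x' y' e)) ->
  (forall e, b' e = a (tperm x' y' e)) -> (forall e, c e = b' (tperm x y e)) ->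
  [disjoint [set x; y] & [set x'; y']] ->
  diffeomorphic (cob_comp (trace a b) (trace b c)) (cob_comp (trace a b') (trace b' c)).
Proof.
move=> xy xy' abE bcE abE' bcE' dis.
have tperm_out u v e : e \notin [set u; v] -> tperm u v e = e.
  by rewrite !inE => /norP[eu ev]; apply: tpermD; rewrite eq_sym.
have bP e : b e = a e \/ b e = c e.
  case: (boolP (e \in [set x; y])) => exy; last by left; rewrite abE tperm_out.
  by right; rewrite bcE tperm_out // (disjointFr dis exy).
have bP' e : b' e = a e \/ b' e = c e.
  case: (boolP (e \in [set x'; y'])) => exy; last by left; rewrite abE' tperm_out.
  by right; rewrite bcE' tperm_out // (disjointFl dis exy).
pose S := cob_comp (trace a b) (trace b c); pose S' := cob_comp (trace a b') (trace b' c).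
pose f (z : sphere S) : sphere S' := match z with
  | inl X => inl (to_pi0 (join_rel a b') (val X))
  | inr X => inr (to_pi0 (join_rel b' c) (val X)) end.
pose g (z : sphere S') : sphere S := match z with
  | inl X => inl (to_pi0 (join_rel a b) (val X))
  | inr X => inr (to_pi0 (join_rel b c) (val X)) end.
have [Pab Pbc Pab' Pbc' PQ] :=
  @two_traces_conn _ a b b' c bP' (fun e => inl (to_pi0 _ e)) (fun e => sheet_conn_refl _).
have [Pab2 Pbc2 Pab2' Pbc2' PQ2] :=
  @two_traces_conn _ a b' b c bP (fun e => inl (to_pi0 _ e)) (fun e => sheet_conn_refl _).
have Q e e' : @sheet_conn _ _ S (inl (to_pi0 (join_rel a b) e)) (inl (to_pi0 (join_rel a b) e')) ->
   @sheet_conn _ _ S (inr (to_pi0 (join_rel b c) e)) (inr (to_pi0 (join_rel b c) e')).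
  move=> ee'; apply: sheet_conn_trans (PQ e'); apply: sheet_conn_trans ee'.
  by rewrite sheet_conn_sym.
have Q2 e e' : @sheet_conn _ _ S' (inl (to_pi0 (join_rel a b') e))
    (inl (to_pi0 (join_rel a b') e')) ->
   @sheet_conn _ _ S' (inr (to_pi0 (join_rel b' c) e)) (inr (to_pi0 (join_rel b' c) e')).
  move=> ee'; apply: sheet_conn_trans (PQ2 e'); apply: sheet_conn_trans ee'.
  by rewrite sheet_conn_sym.
apply: (@sheet_equiv_diffeo _ _ S S' f g); do 2!split.
- case=> [[[]|[]]|w] /=; apply: sheet_conn_trans (Q2 (val w) _ _).
    by apply: sheet_conn_trans (PQ2 _); apply: Pab2'; apply: conn_val.
  by apply: Pbc2'; rewrite conn_sym; apply: conn_val.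
- case=> [[[]|[]]|w] /=; apply: sheet_conn_trans (Q (val w) _ _).
    by apply: sheet_conn_trans (PQ _); apply: Pab'; apply: conn_val.
  by apply: Pbc'; rewrite conn_sym; apply: conn_val.
- case=> X /=; rewrite -{2}(to_pi0_val X); first by apply: Pab'; apply: conn_val.
  by apply: Q; apply: Pbc'; apply: conn_val.
- case=> X /=; rewrite -{2}(to_pi0_val X); first by apply: Pab2'; apply: conn_val.
  by apply: Q2; apply: Pbc2'; apply: conn_val.
- by move=> w; apply: Pab2'; apply: conn_val.
- by move=> w; apply: Q2; apply: Pbc2'; apply: conn_val.
move=> q qs; pose q' e := q (inl (to_pi0 (join_rel a b') e)).
have qq e e' : @sheet_conn _ _ S' (inl (to_pi0 (join_rel a b') e))
    (inl (to_pi0 (join_rel a b') e')) -> q' e = q' e'.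
  exact: stable_sheets.
have qr e : q (inr (to_pi0 (join_rel b' c) e)) = q' e by rewrite /q' (stable_sheets qs (PQ2 e)).
have s1 : stable (join_rel a b) q' by move=> u v /conn1 /Pab2' /qq.
have s2 : stable (join_rel b c) q' by move=> u v /conn1 /Pbc2' /qq.
have s3 : stable (join_rel a b') q' by move=> u v /conn1 /Pab2 /qq.
have s4 : stable (join_rel b' c) q' by move=> u v /conn1 /Pbc2 /qq.
rewrite !spheres_in_comp !tubes_in_comp.
have -> : spheres_in (fun p => (q \o f) (inl p)) = class_count (join_rel a b) q' by [].
have -> : spheres_in (fun p => (q \o f) (inr p)) = class_count (join_rel b c) q'.
  by apply: eq_bigr => X _; rewrite /= qr.
have -> : spheres_in (fun p : sphere (trace a b') => q (inl p)) = class_count (join_rel a b') q'.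
  by apply: eq_bigr => X _; rewrite /q' to_pi0_val.
have -> : spheres_in (fun p : sphere (trace b' c) => q (inr p)) = class_count (join_rel b' c) q'.
  by apply: eq_bigr => X _; rewrite -qr to_pi0_val.
have -> : \sum_w q (inl (tgt (trace a b') w)) = class_count (frel b') q' by [].
have -> : \sum_w (q \o f) (inl (tgt (trace a b) w)) = class_count (frel b) q'.
  by apply: eq_bigr => w _; rewrite /= -/(q' _) (val_stable s1).
rewrite /tubes_in !big_pred0; [|by case..].
have := class_count_surgery xy abE s1; have := class_count_surgery xy' bcE s2.
have := class_count_surgery xy' abE' s3; have := class_count_surgery xy bcE' s4.
lia.
Qed.

(** * The category algebra of the cobordism category *)

Local Open Scope quotient_scope.
Local Open Scope ring_scope.

(* cobordism lives in too large a universe to carry a choiceType structure;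
   up to diffeomorphism the spheres and the tubes can be numbered, which gives a
   small type. *)
Definition code_data (W0 W1 : manifold) (nm : nat * nat) : choiceType :=
  ({ffun 'I_nm.2 -> 'I_nm.1 * 'I_nm.1} * {ffun circles W0 -> 'I_nm.1} *
   {ffun circles W1 -> 'I_nm.1})%type.

Definition code (W0 W1 : manifold) : choiceType := {nm : nat * nat & code_data W0 W1 nm}.

Section Codes.
Variables (W0 W1 : manifold).

Definition decode (c : code W0 W1) : cobordism W0 W1 :=
  Cobordism 'I_(tag c).1 'I_(tag c).2 (fun t => (tagged c).1.1 t)
    (fun w => (tagged c).1.2 w) (fun w => (tagged c).2 w).

Definition encode (S : cobordism W0 W1) : code W0 W1 :=
  @Tagged _ (#|sphere S|, #|tube S|) (code_data W0 W1)
    (([ffun t => let e := ends (enum_val t) in (enum_rank e.1, enum_rank e.2)],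
      [ffun w => enum_rank (src S w)]), [ffun w => enum_rank (tgt S w)]).

Lemma encodeK S : diffeomorphic S (decode (encode S)).
Proof.
apply: (@iso_diffeo _ _ S (decode (encode S)) enum_rank enum_val enum_rank enum_val).
- exact: enum_rankK.
- exact: enum_valK.
- exact: enum_rankK.
- exact: enum_valK.
- by move=> t; rewrite /= ffunE enum_rankK.
- by move=> w; rewrite /= ffunE.
by move=> w; rewrite /= ffunE.
Qed.

Variable k : comPzRingType.

Definition decode_hom (f : seq (k * code W0 W1)) : cob_hom k W0 W1 :=
  [seq (u.1, decode u.2) | u <- f].

Definition encode_hom (f : cob_hom k W0 W1) : seq (k * code W0 W1) :=
  [seq (u.1, encode u.2) | u <- f].

Lemma encode_homK f : hom_eq f (decode_hom (encode_hom f)).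
Proof.
elim: f => [|[a S] f IHf] /=; first exact: hom_refl.
rewrite -[_ :: f]/([:: _] ++ f) -[X in hom_eq _ X]/([:: _] ++ decode_hom (encode_hom f)).
exact: hom_cat (hom_diffeo _ (encodeK S)) IHf.
Qed.

(** The inductive congruence is made boolean classically, as the quotient type demands. *)
Definition code_hom_eq (f g : seq (k * code W0 W1)) : bool :=
  `[< hom_eq (decode_hom f) (decode_hom g) >].

Lemma code_hom_eq_refl : reflexive code_hom_eq.
Proof. by move=> f; apply/asboolP; apply: hom_refl. Qed.

Lemma code_hom_eq_sym : symmetric code_hom_eq.
Proof. by move=> f g; apply/asboolP/asboolP; apply: hom_sym. Qed.

Lemma code_hom_eq_trans : transitive code_hom_eq.
Proof.
by move=> f g h /asboolP gf /asboolP fh; apply/asboolP; apply: hom_trans fh.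
Qed.

Canonical code_hom_equiv :=
  EquivRel code_hom_eq code_hom_eq_refl code_hom_eq_sym code_hom_eq_trans.

Definition quot_hom : Type := {eq_quot code_hom_eq}.
HB.instance Definition _ := Choice.on quot_hom.
HB.instance Definition _ := EqQuotient.on quot_hom.
End Codes.

(** * Modules of morphisms as quotients *)

Section QuotHom.
Variables (k : comPzRingType) (W0 W1 : manifold).
Notation Q := (quot_hom W0 W1 k).
Implicit Types (f g : cob_hom k W0 W1) (x y z : Q).

Definition cls f : Q := \pi_Q (encode_hom f).
Definition rep x : cob_hom k W0 W1 := decode_hom (repr x).

Lemma clsP f g : cls f = cls g <-> hom_eq f g.
Proof.
split=> [/eqmodP/asboolP fg|fg].
  apply: hom_trans (encode_homK f) _; apply: hom_trans fg _.
  exact: hom_sym (encode_homK g).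
apply/eqmodP/asboolP; apply: hom_trans (hom_sym (encode_homK f)) _.
exact: hom_trans fg (encode_homK g).
Qed.

Lemma repK x : cls (rep x) = x.
Proof.
rewrite -[RHS]reprK; apply/eqmodP/asboolP.
exact: hom_sym (encode_homK (rep x)).
Qed.

Definition qadd x y := cls (rep x ++ rep y).

Lemma cls_cat f g : cls (f ++ g) = qadd (cls f) (cls g).
Proof. by apply/clsP/hom_cat; apply/clsP; rewrite repK. Qed.

Lemma qaddA : associative qadd.
Proof.
by move=> x y z; rewrite -(repK x) -(repK y) -(repK z) -!cls_cat catA.
Qed.

Lemma qaddC : commutative qadd.
Proof. by move=> x y; apply/clsP/hom_catC. Qed.

Lemma qadd0 : left_id (cls [::]) qadd.
Proof. by move=> x; rewrite -[in LHS](repK x) -cls_cat repK. Qed.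

HB.instance Definition _ := GRing.isNmodule.Build Q qaddA qaddC qadd0.

Definition gen a (S : cobordism W0 W1) : Q := cls [:: (a, S)].

Lemma cls0 : cls [::] = 0. Proof. by []. Qed.

Lemma clsD f g : cls (f ++ g) = cls f + cls g. Proof. exact: cls_cat. Qed.

Lemma clsE f : cls f = \sum_(u <- f) gen u.1 u.2.
Proof.
elim: f => [|[a S] f IHf]; first by rewrite big_nil.
by rewrite big_cons -IHf -clsD.
Qed.

Lemma genD a b S : gen (a + b) S = gen a S + gen b S.
Proof. by rewrite -clsD; apply/esym/clsP/hom_coefD. Qed.

Lemma gen0 S : gen 0 S = 0.
Proof. by apply/clsP/hom_coef0. Qed.

Definition qopp x := cls [seq (- u.1, u.2) | u <- rep x].

Lemma qaddN : left_inverse 0 qopp +%R.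
Proof.
move=> x; rewrite /qopp -[in X in _ + X](repK x) !clsE big_map -big_split /= big1 // => u _.
by rewrite -genD addNr gen0.
Qed.

HB.instance Definition _ := GRing.Nmodule_isZmodule.Build Q qaddN.

Lemma genN a S : gen (- a) S = - gen a S.
Proof. by apply/eqP; rewrite -addr_eq0 -genD addNr gen0. Qed.

Lemma gen_diffeo a S S' : diffeomorphic S S' -> gen a S = gen a S'.
Proof. by move=> SS'; apply/clsP/hom_diffeo. Qed.

Lemma gen_4Tu a S (p1 p2 p3 p4 : sphere S) :
  gen a (add_tube p1 p2) + gen a (add_tube p3 p4) =
  gen a (add_tube p1 p3) + gen a (add_tube p2 p4).
Proof. by rewrite -!clsD; apply/clsP/hom_4Tu. Qed.

Lemma cls_big (I : finType) (F : I -> cob_hom k W0 W1) :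
  cls (\big[cat/[::]]_i F i) = \sum_i cls (F i).
Proof. exact: (big_morph cls clsD cls0). Qed.

(** The universal property of the presentation: an assignment respecting each defining relation
    descends to classes. It makes composition well defined in each argument. *)
Lemma hom_eq_sum (M : zmodType) (F : k -> cobordism W0 W1 -> M) :
  (forall S, F 0 S = 0) -> (forall a b S, F (a + b) S = F a S + F b S) ->
  (forall a S S', diffeomorphic S S' -> F a S = F a S') ->
  (forall a S, F a (add_sphere S) = 0) ->
  (forall a S, F a (add_torus S) = F (a *+ 2) S) ->
  (forall a S (p1 p2 p3 p4 : sphere S),
     F a (add_tube p1 p2) + F a (add_tube p3 p4) =
     F a (add_tube p1 p3) + F a (add_tube p2 p4)) ->
  forall f g, hom_eq f g -> \sum_(u <- f) F u.1 u.2 = \sum_(u <- g) F u.1 u.2.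
Proof.
move=> F0 FD Fd FS FT F4 f g; elim=> {f g} /=.
- by [].
- by move=> f g _ ->.
- by move=> f g h _ -> _ ->.
- by move=> f f' g g' _ Ef _ Eg; rewrite !big_cat /= Ef Eg.
- by move=> f g; rewrite !big_cat /= addrC.
- by move=> S; rewrite big_seq1 big_nil F0.
- by move=> a b S; rewrite !big_cons !big_nil /= !addr0 FD.
- by move=> a S S' SS'; rewrite !big_seq1; apply: Fd.
- by move=> a S; rewrite big_seq1 big_nil FS.
- by move=> a S; rewrite !big_seq1 FT.
by move=> a S p1 p2 p3 p4; rewrite !big_cons !big_nil /= !addr0 F4.
Qed.

End QuotHom.

(* exchange_big cannot be used for sums indexed by cobordisms: its index types
   are constrained to lie in a small universe. *)
Lemma sum_exchange (M : nmodType) (A B : Type) (r : seq A) (s : seq B) (F : A -> B -> M) :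
  \sum_(u <- r) \sum_(v <- s) F u v = \sum_(v <- s) \sum_(u <- r) F u v.
Proof.
elim: r => [|u r IHr]; first by rewrite big_nil big1 // => v _; rewrite big_nil.
by rewrite big_cons IHr -big_split; apply: eq_bigr => v _; rewrite big_cons.
Qed.

Section QuotComp.
Variable k : comPzRingType.

Definition qcomp (W0 W1 W2 : manifold) (x : quot_hom W0 W1 k) (y : quot_hom W1 W2 k) :
  quot_hom W0 W2 k := cls (hom_comp (rep x) (rep y)).

Section Bilinear.
Variables (W0 W1 W2 : manifold).
Implicit Types (f : cob_hom k W0 W1) (g : cob_hom k W1 W2).
Implicit Types (x : quot_hom W0 W1 k) (y : quot_hom W1 W2 k).

Lemma cls_hom_comp f g :
  cls (hom_comp f g) = \sum_(u <- f) \sum_(v <- g) gen (u.1 * v.1) (cob_comp u.2 v.2).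
Proof. by rewrite clsE /hom_comp big_allpairs_dep. Qed.

Lemma cls_hom_comp_l f f' g : hom_eq f f' -> cls (hom_comp f g) = cls (hom_comp f' g).
Proof.
rewrite !cls_hom_comp.
apply: (@hom_eq_sum _ _ _ _ (fun a S => \sum_(v <- g) gen (a * v.1) (cob_comp S v.2))).
- by move=> S; apply: big1 => v _; rewrite mul0r gen0.
- by move=> a b S; rewrite -big_split; apply: eq_bigr => v _; rewrite mulrDl genD.
- move=> a S S' SS'; apply: eq_bigr => v _; apply: gen_diffeo.
  by apply: cob_comp_diffeo SS' _; exact: sheet_equiv_diffeo (sheet_equiv_refl _).
- move=> a S; apply: big1 => v _; rewrite (gen_diffeo _ (cob_comp_add_sphere_l _ _)).
  exact/clsP/hom_S.
- move=> a S; apply: eq_bigr => v _; rewrite (gen_diffeo _ (cob_comp_add_torus_l _ _)).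
  by rewrite mulrnAl; apply/clsP/hom_T.
move=> a S p1 p2 p3 p4; rewrite -!big_split; apply: eq_bigr => v _ /=.
by rewrite !(gen_diffeo _ (cob_comp_add_tube_l _ _ _)) gen_4Tu.
Qed.

Lemma cls_hom_comp_r f g g' : hom_eq g g' -> cls (hom_comp f g) = cls (hom_comp f g').
Proof.
have swap (h : cob_hom k W1 W2) : cls (hom_comp f h) =
    \sum_(v <- h) \sum_(u <- f) gen (u.1 * v.1) (cob_comp u.2 v.2).
  by rewrite cls_hom_comp; apply: sum_exchange.
rewrite !swap.
apply: (@hom_eq_sum _ _ _ _ (fun a S => \sum_(v <- f) gen (v.1 * a) (cob_comp v.2 S))).
- by move=> S; apply: big1 => v _; rewrite mulr0 gen0.
- by move=> a b S; rewrite -big_split; apply: eq_bigr => v _; rewrite mulrDr genD.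
- move=> a S S' SS'; apply: eq_bigr => v _; apply: gen_diffeo.
  by apply: cob_comp_diffeo SS'; exact: sheet_equiv_diffeo (sheet_equiv_refl _).
- move=> a S; apply: big1 => v _; rewrite (gen_diffeo _ (cob_comp_add_sphere_r _ _)).
  exact/clsP/hom_S.
- move=> a S; apply: eq_bigr => v _; rewrite (gen_diffeo _ (cob_comp_add_torus_r _ _)).
  by rewrite mulrnAr; apply/clsP/hom_T.
move=> a S p1 p2 p3 p4; rewrite -!big_split; apply: eq_bigr => v _ /=.
by rewrite !(gen_diffeo _ (cob_comp_add_tube_r _ _ _)) gen_4Tu.
Qed.

Lemma qcomp_cls f g : qcomp (cls f) (cls g) = cls (hom_comp f g).
Proof.
rewrite /qcomp (@cls_hom_comp_l _ f); last by apply/clsP; rewrite repK.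
by apply: cls_hom_comp_r; apply/clsP; rewrite repK.
Qed.

Lemma qcomp_gen a S b T : qcomp (@gen k W0 W1 a S) (@gen k W1 W2 b T) = gen (a * b) (cob_comp S T).
Proof. by rewrite /gen qcomp_cls. Qed.

Lemma qcompDl x x' y : qcomp (x + x') y = qcomp x y + qcomp x' y.
Proof.
rewrite -(repK x) -(repK x') -(repK y) -clsD !qcomp_cls !cls_hom_comp.
by rewrite big_cat.
Qed.

Lemma qcompDr x y y' : qcomp x (y + y') = qcomp x y + qcomp x y'.
Proof.
rewrite -(repK x) -(repK y) -(repK y') -clsD !qcomp_cls !cls_hom_comp.
by rewrite -big_split; apply: eq_bigr => u _; rewrite big_cat.
Qed.

Lemma qcomp0l y : qcomp (0 : quot_hom W0 W1 k) y = 0.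
Proof. by apply: (addrI (qcomp (0 : quot_hom W0 W1 k) y)); rewrite -qcompDl !addr0. Qed.

Lemma qcomp0r x : qcomp x (0 : quot_hom W1 W2 k) = 0.
Proof. by apply: (addrI (qcomp x (0 : quot_hom W1 W2 k))); rewrite -qcompDr !addr0. Qed.

Lemma qcompNl x y : qcomp (- x) y = - qcomp x y.
Proof. by apply/eqP; rewrite -addr_eq0 -qcompDl addNr qcomp0l. Qed.

Lemma qcompNr x y : qcomp x (- y) = - qcomp x y.
Proof. by apply/eqP; rewrite -addr_eq0 -qcompDr addNr qcomp0r. Qed.

Lemma qcomp_suml (I : Type) (r : seq I) (P : pred I) (F : I -> quot_hom W0 W1 k) y :
  qcomp (\sum_(i <- r | P i) F i) y = \sum_(i <- r | P i) qcomp (F i) y.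
Proof.
by apply: (big_morph (fun x => qcomp x y)) => [x x'|]; [exact: qcompDl | exact: qcomp0l].
Qed.

Lemma qcomp_sumr (I : Type) (r : seq I) (P : pred I) (F : I -> quot_hom W1 W2 k) x :
  qcomp x (\sum_(i <- r | P i) F i) = \sum_(i <- r | P i) qcomp x (F i).
Proof.
by apply: (big_morph (qcomp x)) => [y y'|]; [exact: qcompDr | exact: qcomp0r].
Qed.

End Bilinear.

Lemma qcompA (W0 W1 W2 W3 : manifold) (x : quot_hom W0 W1 k) (y : quot_hom W1 W2 k)
    (z : quot_hom W2 W3 k) : qcomp x (qcomp y z) = qcomp (qcomp x y) z.
Proof.
rewrite -(repK x) clsE !qcomp_suml; apply: eq_bigr => u _.
rewrite -(repK y) clsE qcomp_suml !qcomp_sumr qcomp_suml; apply: eq_bigr => v _.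
rewrite -(repK z) clsE !qcomp_sumr; apply: eq_bigr => w _.
by rewrite !qcomp_gen mulrA; apply/gen_diffeo/cob_compA.
Qed.

Definition qid (W : manifold) : quot_hom W W k := cls (hom_id k W).

Lemma qcomp1l (W0 W1 : manifold) (x : quot_hom W0 W1 k) : qcomp (qid W0) x = x.
Proof.
rewrite -[in LHS](repK x) clsE qcomp_sumr -[RHS](repK x) clsE.
apply: eq_bigr => u _; rewrite qcomp_gen mul1r.
exact/gen_diffeo/(sheet_equiv_diffeo (cob_id_equiv_l _)).
Qed.

Lemma qcomp1r (W0 W1 : manifold) (x : quot_hom W0 W1 k) : qcomp x (qid W1) = x.
Proof.
rewrite -[in LHS](repK x) clsE qcomp_suml -[RHS](repK x) clsE.
apply: eq_bigr => u _; rewrite qcomp_gen mulr1.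
exact/gen_diffeo/(sheet_equiv_diffeo (cob_id_equiv_r _)).
Qed.

End QuotComp.

(** * The ring of matrices of morphisms *)

Section CategoryAlgebra.
Variables (k : comPzRingType) (I : finType) (ob : I -> manifold).

Definition cat_alg : Type := forall i j : I, quot_hom (ob i) (ob j) k.

HB.instance Definition _ := gen_eqMixin cat_alg.
HB.instance Definition _ := gen_choiceMixin cat_alg.

Implicit Types x y z : cat_alg.

Lemma cat_algP x y : (forall i j, x i j = y i j) -> x = y.
Proof.
by move=> xy; apply: functional_extensionality_dep => i; apply: functional_extensionality_dep.
Qed.

Definition cat_add x y : cat_alg := fun i j => x i j + y i j.
Definition cat_opp x : cat_alg := fun i j => - x i j.
Definition cat_zero : cat_alg := fun i j => 0.
Definition cat_mul x y : cat_alg := fun i l => \sum_j qcomp (x i j) (y j l).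

Definition diag (F : forall i, quot_hom (ob i) (ob i) k) : cat_alg := fun i j =>
  match i =P j with
  | ReflectT e => ecast j' (quot_hom (ob i) (ob j') k) e (F i)
  | ReflectF _ => 0
  end.

Lemma diagE F i : diag F i i = F i.
Proof. by rewrite /diag; case: eqP => // e; rewrite eq_axiomK. Qed.

Lemma diag0 F i j : i != j -> diag F i j = 0.
Proof. by rewrite /diag; case: eqP. Qed.

Lemma cat_addA : associative cat_add.
Proof. by move=> x y z; apply: cat_algP => i j; apply: addrA. Qed.
Lemma cat_addC : commutative cat_add.
Proof. by move=> x y; apply: cat_algP => i j; apply: addrC. Qed.
Lemma cat_add0 : left_id cat_zero cat_add.
Proof. by move=> x; apply: cat_algP => i j; apply: add0r. Qed.
Lemma cat_addN : left_inverse cat_zero cat_opp cat_add.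
Proof. by move=> x; apply: cat_algP => i j; apply: addNr. Qed.

HB.instance Definition _ :=
  GRing.isZmodule.Build cat_alg cat_addA cat_addC cat_add0 cat_addN.

Lemma cat_mulA : associative cat_mul.
Proof.
move=> x y z; apply: cat_algP => i l; rewrite /cat_mul.
under eq_bigr do rewrite qcomp_sumr; rewrite exchange_big; apply: eq_bigr => j _ /=.
by rewrite qcomp_suml; apply: eq_bigr => j' _; rewrite qcompA.
Qed.

Lemma diag_cat_mul F x i l : cat_mul (diag F) x i l = qcomp (F i) (x i l).
Proof.
rewrite /cat_mul (bigD1 i) //= diagE big1 ?addr0 // => j ji.
by rewrite diag0 ?qcomp0l // eq_sym.
Qed.

Lemma cat_mul_diag F x i l : cat_mul x (diag F) i l = qcomp (x i l) (F l).
Proof.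
rewrite /cat_mul (bigD1 l) //= diagE big1 ?addr0 // => j ji.
by rewrite diag0 ?qcomp0r.
Qed.

Definition cat_one : cat_alg := diag (fun i => qid k (ob i)).

Lemma cat_mul1l : left_id cat_one cat_mul.
Proof. by move=> x; apply: cat_algP => i l; rewrite diag_cat_mul qcomp1l. Qed.
Lemma cat_mul1r : right_id cat_one cat_mul.
Proof. by move=> x; apply: cat_algP => i l; rewrite cat_mul_diag qcomp1r. Qed.
Lemma cat_mulDl : left_distributive cat_mul cat_add.
Proof.
move=> x y z; apply: cat_algP => i l; rewrite /cat_add /cat_mul -big_split.
by apply: eq_bigr => j _; apply: qcompDl.
Qed.
Lemma cat_mulDr : right_distributive cat_mul cat_add.
Proof.
move=> x y z; apply: cat_algP => i l; rewrite /cat_add /cat_mul -big_split.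
by apply: eq_bigr => j _; apply: qcompDr.
Qed.

HB.instance Definition _ :=
  GRing.Zmodule_isPzRing.Build cat_alg cat_mulA cat_mul1l cat_mul1r cat_mulDl cat_mulDr.

Lemma cat_algD x y i j : (x + y) i j = x i j + y i j. Proof. by []. Qed.
Lemma cat_algN x i j : (- x) i j = - x i j. Proof. by []. Qed.
Lemma cat_algM x y i l : (x * y) i l = \sum_j qcomp (x i j) (y j l). Proof. by []. Qed.
Lemma cat_alg1 : (1 : cat_alg) = diag (fun i => qid k (ob i)). Proof. by []. Qed.
Lemma diagM F x i l : (diag F * x) i l = qcomp (F i) (x i l).
Proof. exact: diag_cat_mul. Qed.
Lemma Mdiag F x i l : (x * diag F) i l = qcomp (x i l) (F l).
Proof. exact: cat_mul_diag. Qed.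

End CategoryAlgebra.

(** * Perturbation of a contraction *)

Section Perturbation.
Variables (R : pzRingType) (Dm Dp F s0 s1 s2 u1 u2 : R).
Hypotheses (Dm2 : Dm * Dm = 0) (Dp2 : Dp * Dp = 0) (DF : Dm * F = F * Dp).
Hypotheses (s0F : s0 * F = 0) (Fs2 : F * s2 = 0).
Let a1 := F * s1 - (Dm * s0 + s0 * Dm).
Let a2 := s1 * F + (Dp * s2 + s2 * Dp).
Let b := Dp * s1 - s1 * Dm.
Hypotheses (u1a1 : u1 * a1 = 1) (a1u1 : a1 * u1 = 1).
Hypotheses (u2a2 : u2 * a2 = 1) (a2u2 : a2 * u2 = 1).

(** With products read from left to right, the cone has the differential d = [[-Dm, F], [0, Dp]] and
    the candidate contraction is h = [[s0, 0], [s1, s2]]. Then A = d h + h d = [[a1, 0], [b, a2]],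
    the upper right entry vanishing by [s0F] and [Fs2]. As A commutes with d, the product h A^-1 is
    a true contraction. This element is its lower left entry; the diagonal entries are [s0 * u1] and
    [s2 * u2]. *)
Definition perturbed_inverse := s1 * u1 - s2 * u2 * b * u1.
Local Notation G := perturbed_inverse.

(** This and the next three identities are the entries of d A = A d. *)
Let Da1 : Dm * a1 = a1 * Dm + F * b.
Proof.
rewrite /a1 /b !mulrBr !mulrBl !mulrDr !mulrDl !mulrA Dm2 mul0r add0r.
by rewrite -(mulrA s0) Dm2 mulr0 addr0 DF [RHS]addrC subrKA.
Qed.

Let a1F : a1 * F = F * a2.
Proof.
rewrite /a1 /a2 mulrBl mulrDl !mulrDr !mulrA -(mulrA Dm) s0F mulr0 add0r.
by rewrite -(mulrA s0) DF mulrA s0F mul0r subr0 -DF -!(mulrA Dm) Fs2 mulr0 mul0r !addr0.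
Qed.

Let Da2 : Dp * a2 = b * F + a2 * Dp.
Proof.
rewrite /a2 /b mulrBl !mulrDr !mulrDl !mulrA Dp2 mul0r add0r.
by rewrite -(mulrA s1 Dm) DF -(mulrA s2) Dp2 mulr0 addr0 mulrA addrA subrK.

Qed.

Let Db : Dp * b = - (b * Dm).
Proof.
by rewrite /b mulrBr mulrBl !mulrA Dp2 mul0r -!mulrA Dm2 mulr0 subr0 sub0r mulrA.
Qed.

Let u1F : u1 * F = F * u2.
Proof. by rewrite -[LHS]mulr1 -a2u2 mulrA -(mulrA u1) -a1F !mulrA u1a1 mul1r. Qed.

Let cancel1 x y : x * a1 = y * a1 -> x = y.
Proof. by move=> /(congr1 ( *%R^~ u1)); rewrite -!mulrA a1u1 !mulr1. Qed.

Let cancel2 x y : x * a2 = y * a2 -> x = y.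
Proof. by move=> /(congr1 ( *%R^~ u2)); rewrite -!mulrA a2u2 !mulr1. Qed.

Let Ga1 : G * a1 = s1 - s2 * u2 * b.
Proof. by rewrite /G mulrBl -!(mulrA _ u1) u1a1 !mulr1. Qed.

(** This identity and the next two are entries of the equation saying that h A^-1 is a contraction;
    each is checked after multiplication by [a1] or [a2] on the right. *)
Lemma perturbed_inverse_l : F * G = 1 + (Dm * (s0 * u1) + s0 * u1 * Dm).
Proof.
apply: cancel1; rewrite -mulrA Ga1 mulrBr !mulrA Fs2 !mul0r subr0.
rewrite !mulrDl mul1r -!(mulrA _ u1) u1a1 mulr1 -!mulrA Da1 mulrDr (mulrA u1 F) u1F.
by rewrite mulrDr !mulrA s0F !mul0r addr0 -(mulrA s0 u1 a1) u1a1 mulr1 /a1 subrK.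
Qed.

Lemma perturbed_inverse_r : G * F = 1 - (Dp * (s2 * u2) + s2 * u2 * Dp).
Proof.
have dec : s2 * u2 * Dp * a2 = s2 * u2 * b * F + s2 * Dp.
  by rewrite -mulrA Da2 mulrDr !mulrA -(mulrA s2 u2 a2) u2a2 mulr1.
apply: cancel2; rewrite -mulrA -a1F mulrA Ga1 !mulrBl mul1r mulrDl dec.
rewrite -[Dp * (s2 * u2) * a2]mulrA -[s2 * u2 * a2]mulrA u2a2 mulr1 /a2.
have ar (x y p q : R) : x - y = x + (p + q) - (p + (y + q)).
  by rewrite (addrC y) (addrA p) opprD addrA addrK.
exact: ar.
Qed.

Lemma perturbed_inverse_chain : Dp * G = G * Dm.
Proof.
have dec : s2 * u2 * Dp * b = - (s2 * u2 * b * Dm).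
  by rewrite -mulrA Db mulrN mulrA.
apply: cancel1; rewrite -!mulrA Ga1 Da1.
rewrite [RHS](_ : _ = (G * a1) * Dm + (G * F) * b); last by rewrite mulrDr !mulrA.
rewrite Ga1 perturbed_inverse_r !mulrBl mul1r mulrDl dec.
rewrite mulrBr !mulrA opprB addrC.
have ar (x y p q : R) : - y + p = q - x + ((p - q) + (x - y)).
  by rewrite addrACA (addrC q) subrK addKr addrC.
exact: ar.
Qed.

End Perturbation.

(** * Smoothings and saddles *)

Lemma add_tubeC (W0 W1 : manifold) (S : cobordism W0 W1) (p q : sphere S) :
  diffeomorphic (@add_tube _ _ S p q) (@add_tube _ _ S q p).
Proof.
pose A x y := @add_tube _ _ S x y.
have tA x y : @sheet_conn _ _ (A x y) x y := @sheet_conn_tube _ _ (A x y) None.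
apply: (@sheet_equiv_diffeo _ _ (A p q) (A q p) id id); do 2!split=> //.
- case=> [t|] /=; last by rewrite sheet_conn_sym; apply: tA.
  by apply: add_tube_sheet_conn; apply: sheet_conn_tube.
- case=> [t|] /=; last by rewrite sheet_conn_sym; apply: tA.
  by apply: add_tube_sheet_conn; apply: sheet_conn_tube.
move=> r rs; rewrite !tubes_in_add_tube /=.
by rewrite (stable_sheets rs (tA q p)).
Qed.

Section Smoothings.
Variable P : shadow.
Implicit Types (s t : state P) (c v : crossing P) (e : edge P).

Definition flip v s : state P := [ffun c => s c (+) (c == v)].

Lemma flip_at v s : flip v s v = ~~ s v.
Proof. by rewrite ffunE eqxx addbT. Qed.

Lemma flip_away v s c : c != v -> flip v s c = s c.
Proof. by rewrite ffunE => /negbTE->; rewrite addbF. Qed.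

Lemma flipK v : involutive (flip v).
Proof. by move=> s; apply/ffunP => c; rewrite !ffunE addbK. Qed.

Lemma flipC v v' s : flip v (flip v' s) = flip v' (flip v s).
Proof. by apply/ffunP => c; rewrite !ffunE addbAC. Qed.

(* The two edges arriving at the crossing v when the edges are oriented as the
   boundary of the black region. *)
Definition arriving v (b : bool) : edge P :=
  inl (depart (glue P) (~~ (black (s := P) (inl (v, false)) (+) b)) (v, b)).

Lemma black_arriving v b :
  black (s := P) (arriving v b) = black (s := P) (inl (v, false)) (+) b.
Proof. by rewrite /arriving black_depart. Qed.

Lemma next_arriving s v b : arc_next (smoothing s) (arriving v b) =
  let o := black (s := P) (inl (v, false)) (+) b in
  inl (if s v then depart (glue P) (~~ o) (v, ~~ b) else depart (glue P) o (v, b)).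
Proof.
rewrite permE black_arriving /arriving /step; set o := _ (+) b.
by rewrite -[X in arrive _ X]negbK departK.
Qed.

Lemma edge_arriving e :
  (exists i, e = inr i) \/ exists v b, e = arriving v b.
Proof.
case: e => [x|i]; last by left; exists i.
right; set o := black (s := P) (inl x).
case E: (arrive (glue P) o x) => [v b]; exists v, b.
have Ex : x = depart (glue P) (~~ o) (v, b) by rewrite -E arriveK.
have Eo : black (s := P) (inl (v, false)) (+) b = o by rewrite /o Ex black_depart.
by rewrite /arriving Eo -Ex.
Qed.

Lemma arriving_inj v b v' b' : arriving v b = arriving v' b' -> (v, b) = (v', b').
Proof.
move=> E; have := congr1 (black (s := P)) E; rewrite !black_arriving => Eb.
move: E; rewrite /arriving Eb => -[] /(can_inj (@departK _ _ _)) //.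
Qed.

(** At [v] two edges arrive and two depart in the orientation by color, and the two smoothings are
    the two ways to pair them. Hence saddles are traces of surgeries. *)
Lemma next_flip v s e : arc_next (smoothing (flip v s)) e =
  arc_next (smoothing s) (tperm (arriving v false) (arriving v true) e).
Proof.
have [[i ->]|[c [b ->]]] := edge_arriving e.
  by rewrite tpermD // !permE.
have [->|cv] := eqVneq c v.
  rewrite next_arriving flip_at; case: b; rewrite ?tpermL ?tpermR next_arriving;
  case: (s v); rewrite /= ?addbT ?addbF ?negbK //.
rewrite tpermD; try by apply/eqP => /arriving_inj [E _]; rewrite E eqxx in cv.
by rewrite !next_arriving flip_away.
Qed.

Lemma arriving_neq v : arriving v false != arriving v true.
Proof. by apply/eqP => /arriving_inj []. Qed.

(** Depending on the color, the edge arriving on the left is the one naming the strand or its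
    predecessor on the circle. *)
Lemma left_strandE s v : s v = false ->
  left_strand s v = to_pi0 (frel (arc_next (smoothing s))) (arriving v false).
Proof.
move=> sv; apply: to_pi0P; have := next_arriving s v false; rewrite sv addbF /=.
rewrite /arriving addbF; case: (black _) => /= E; last exact: conn_refl.
by rewrite conn_sym; apply: conn1; rewrite /= E.
Qed.

Lemma right_strandE s v : s v = false ->
  right_strand s v = to_pi0 (frel (arc_next (smoothing s))) (arriving v true).
Proof.
move=> sv; apply: to_pi0P; have := next_arriving s v true; rewrite sv addbT /=.
rewrite /arriving addbT negbK; case: (black _) => /= E; first exact: conn_refl.
by rewrite conn_sym; apply: conn1; rewrite /= E.
Qed.

Lemma saddles_commute v v' s : v != v' ->
  diffeomorphic (cob_comp (saddle s (flip v s)) (saddle (flip v s) (flip v' (flip v s))))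
                (cob_comp (saddle s (flip v' s)) (saddle (flip v' s) (flip v' (flip v s)))).
Proof.
move=> vv'; apply: (@two_traces_diffeo (edge P) _ _ _ _ _ _ _ _ (arriving_neq v) (arriving_neq v')).
- by move=> e; rewrite next_flip.
- by move=> e; rewrite next_flip.
- by move=> e; rewrite next_flip.
- by move=> e; rewrite -flipC next_flip.
rewrite -setI_eq0; apply/eqP/setP => e; rewrite !inE; apply/negP => /andP[].
by case/orP => /eqP -> /orP[] /eqP /arriving_inj /(congr1 fst) /= E; move: vv'; rewrite E eqxx.
Qed.

(** The side of the diagram is constant along every circle, because only the horizontal smoothing of
    [c0] could lead from one side to the other. *)
Lemma strands_differ s c0 : reducible c0 -> s c0 = false ->
  ~~ conn (frel (arc_next (smoothing s))) (arriving c0 false) (arriving c0 true).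
Proof.
case=> side /= reg sc0; rewrite -to_pi0_eq -left_strandE // -right_strandE //.
pose part (x : strand_end (ncross P)) := if x.1 == c0 then x.2 else side x.1.
(* A crossingless component is a circle of its own, so its value is arbitrary. *)
pose epart e := if e is inl x then part x else false.
rewrite to_pi0_eq; apply/negP => lr.
suff : epart (inl (c0, false)) = epart (inl (c0, true)) by rewrite /= /part /= eqxx.
apply: (conn_stable _ lr) => e f /eqP <-.
rewrite permE; case: e => [x|//]; set o := black _; rewrite /step.
have reg' x' : part ((glue P)^-1%g x') = part x'.
  by rewrite -[in RHS](permKV (glue P) x'); apply/esym/reg.
have regd o' z : part (depart (glue P) o' z) = part z by case: o' => //=.
have rega o' z : part (arrive (glue P) o' z) = part z.
  by case: o' => //=; apply: reg.
rewrite /= -(rega o x); case: (arrive _ _ _) => [c b].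
case: ifP => sc; rewrite -[RHS]/(part (depart _ _ _)) regd // /part /=.
by case: eqP => // E; rewrite E sc0 in sc.
Qed.

Section LocalModel.
Variables (s : state P) (c0 : crossing P).
Hypotheses (red : reducible c0) (sc0 : s c0 = false).
Let t := flip c0 s.
Let L := left_strand s c0.
Let R := right_strand s c0.

Lemma cap_after_split :
  diffeomorphic (cob_comp (saddle t s) (cut_src (saddle s t) L)) (cob_id (smoothing t)).
Proof.
rewrite /L left_strandE //.
exact: (cut_split_merge (arriving_neq c0) (next_flip c0 s) (strands_differ red sc0)).
Qed.

Lemma merge_after_birth :
  diffeomorphic (cob_comp (cut_tgt (saddle t s) L) (saddle s t)) (cob_id (smoothing t)).
Proof.
rewrite /L left_strandE //.
exact: (split_cut_merge (arriving_neq c0) (next_flip c0 s) (strands_differ red sc0)).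
Qed.

Lemma split_after_cap :
  diffeomorphic (cob_comp (cut_src (saddle s t) L) (saddle t s))
    (@add_tube _ _ (cut_tgt (cob_id (smoothing s)) L) None (Some R)).
Proof.
rewrite /L /R left_strandE // right_strandE //.
exact: (cut_merge_split (arriving_neq c0) (next_flip c0 s) (strands_differ red sc0)).
Qed.

Lemma birth_after_merge :
  diffeomorphic (cob_comp (saddle s t) (cut_tgt (saddle t s) L))
    (@add_tube _ _ (cut_tgt (cob_id (smoothing s)) L) (Some L) (Some R)).
Proof.
rewrite /L /R left_strandE // right_strandE //.
exact: (merge_split_cut (arriving_neq c0) (next_flip c0 s) (strands_differ red sc0)).
Qed.

End LocalModel.
End Smoothings.

(** * Degrees *)

Section Degrees.
Variables (k : comPzRingType) (I : finType) (ob : I -> manifold).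
Implicit Types (x y : cat_alg k ob) (w : I -> int) (d e : int).

(** Source and target have separate weights because a state can have different degrees in the two
    complexes. *)
Definition homogeneous w w' d x := forall i j, w' j != w i + d -> x i j = 0.

Lemma homogeneousD w w' d x y :
  homogeneous w w' d x -> homogeneous w w' d y -> homogeneous w w' d (x + y).
Proof. by move=> hx hy i j ij; rewrite cat_algD hx ?hy ?addr0. Qed.

Lemma homogeneousN w w' d x : homogeneous w w' d x -> homogeneous w w' d (- x).
Proof. by move=> hx i j ij; rewrite cat_algN hx ?oppr0. Qed.

Lemma homogeneousM w w' w'' d e x y :
  homogeneous w w' d x -> homogeneous w' w'' e y -> homogeneous w w'' (d + e) (x * y).
Proof.
move=> hx hy i l il; rewrite cat_algM big1 // => j _.
have [ij|ij] := eqVneq (w' j) (w i + d); last by rewrite hx ?qcomp0l.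
by rewrite [y j l]hy ?qcomp0r // ij -addrA.
Qed.

Lemma homogeneous_diag w w' (F : forall i, quot_hom (ob i) (ob i) k) :
  (forall i, w' i != w i -> F i = 0) -> homogeneous w w' 0 (diag F).
Proof.
move=> hF i j; rewrite addr0; have [<-|ij] := eqVneq i j; last by rewrite diag0.
by rewrite diagE => /hF.
Qed.

Lemma homogeneous1 w : homogeneous w w 0 1.
Proof. by apply: homogeneous_diag => i; rewrite eqxx. Qed.

Lemma homogeneousX w d x n : homogeneous w w d x -> homogeneous w w (d *+ n) (x ^+ n).
Proof.
move=> hx; elim: n => [|n IHn]; first exact: homogeneous1.
by rewrite exprS mulrS; apply: homogeneousM hx IHn.
Qed.

(** All weights lie between [- M] and [M], so raising one by more than [M + M] leaves the range. *)
Lemma homogeneous_nilpotent w x : homogeneous w w 1 x -> exists n, x ^+ n = 0.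
Proof.
move=> hx; pose M := (\sum_i `|w i|%N)%N.
have leM i : (`|w i| <= M)%N by rewrite /M (bigD1 i) //= leq_addr.
exists (M + M).+1; apply: cat_algP => i j; apply: (homogeneousX (n := (M + M).+1) hx).
by apply/eqP => E; have := leM i; have := leM j; lia.
Qed.

(** The inverse is the geometric series in [1 - x]: the grading [w'] makes it finite, and as a
    polynomial in [x] it keeps degree 0 for [w]. *)
Lemma homogeneous_inverse w w' x :
  homogeneous w w 0 x -> homogeneous w' w' 1 (x - 1) ->
  exists u, [/\ u * x = 1, x * u = 1 & homogeneous w w 0 u].
Proof.
move=> hx /homogeneousN /homogeneous_nilpotent[n nil].
have hy : homogeneous w w 0 (- (x - 1)).
  by apply/homogeneousN/homogeneousD => //; apply/homogeneousN/homogeneous1.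
set y := - (x - 1) in nil hy; exists (\sum_(i < n) y ^+ i).
have xE : x = 1 - y by rewrite /y opprK addrC subrK.
have xu : x * \sum_(i < n) y ^+ i = 1.
  by have := subrX1 y n; rewrite nil sub0r -opprB -xE mulNr => /oppr_inj ->.
split=> //.
  rewrite -[RHS]xu; apply/esym/commr_sum => i _; rewrite xE.
  by apply/commrX; rewrite /GRing.comm mulrBl mulrBr mul1r mulr1.
elim/big_ind: _ => // [u v|i _]; first exact: homogeneousD.
by have := homogeneousX (n := i) hy; rewrite mul0rn.
Qed.

End Degrees.

(** * From the ring back to graded morphisms *)

Section GradedObjects.
Variables (k : comPzRingType) (I : finType) (ob : I -> manifold).
Implicit Types (w : I -> int) (x y : cat_alg k ob).

Definition graded_obj w (n : int) : obj := @Obj {i : I | w i == n} (fun i => ob (val i)).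

Definition represents w w' n n' (f : mor k (graded_obj w n) (graded_obj w' n')) x :=
  forall i j, cls (f i j) = x (val i) (val j).

Definition graded_part w w' n n' x : mor k (graded_obj w n) (graded_obj w' n') :=
  fun i j => rep (x (val i) (val j)).

Lemma graded_part_represents w w' n n' x :
  represents (graded_part (w := w) (w' := w') (n := n) (n' := n') x) x.
Proof. by move=> i j; rewrite repK. Qed.

Lemma represents_eq w w' n n' f g x : @represents w w' n n' f x ->
  @represents w w' n n' g x -> mor_eq f g.
Proof. by move=> fx gx i j; apply/clsP; rewrite fx gx. Qed.

Lemma represents_add w w' n n' f g x y : @represents w w' n n' f x ->
  @represents w w' n n' g y -> represents (mor_add f g) (x + y).
Proof. by move=> fx gy i j; rewrite clsD fx gy. Qed.

Lemma represents_id w n : represents (@mor_id k (graded_obj w n)) 1.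
Proof.
move=> i j; rewrite cat_alg1; have [<-|ij] := eqVneq i j.
  by rewrite diagE /mor_id; case: eqP => // e; rewrite eq_axiomK.
by rewrite diag0 ?val_eqE // /mor_id; case: eqP => // e; rewrite e eqxx in ij.
Qed.

(** The ring product runs over all states, the composite only over those of degree [n']; homogeneity
    of the first factor kills the other terms. *)
Lemma represents_comp w w' w'' n n' n'' d f g x y :
  @represents w w' n n' f x -> @represents w' w'' n' n'' g y ->
  homogeneous w w' d x -> n' = n + d -> represents (mor_comp f g) (x * y).
Proof.
move=> fx gy hx En i l; rewrite cls_big cat_algM.
under eq_bigr do rewrite -qcomp_cls fx gy.
rewrite -(big_sub (fun j => w' j == n') (fun j => qcomp (x (val i) j) (y j (val l)))).
rewrite [LHS]big_mkcond; apply: eq_bigr => j _; case: ifPn => // ij.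
by rewrite hx ?qcomp0l // (eqP (valP i)) -En.
Qed.

End GradedObjects.

Lemma sum_antisymmetric (M : zmodType) (n : nat) (F : 'I_n -> 'I_n -> M) :
  (forall i, F i i = 0) -> (forall i j, i != j -> F i j = - F j i) ->
  \sum_i \sum_j F i j = 0.
Proof.
move=> F0 FN.
rewrite (_ : \sum_i _ = \sum_(i : 'I_n)
    (\sum_(j : 'I_n | (i < j)%N) F i j + \sum_(j : 'I_n | (j < i)%N) F i j)).
  rewrite big_split /= [X in _ + X](exchange_big_dep predT) //= -big_split big1 // => i _.
  rewrite -big_split big1 // => j ij; rewrite (FN i j); first exact: addNr.
  by apply/negP => /eqP E; rewrite E ltnn in ij.
apply: eq_bigr => i _; rewrite (bigID (fun j : 'I_n => (i < j)%N)) /=; congr (_ + _).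
rewrite (bigID (fun j : 'I_n => (j < i)%N)) /= [X in _ + X]big1 ?addr0.
  by apply: eq_bigl => j; case: ltngtP.
move=> j /andP[]; rewrite -!leqNgt => ji ij.
by rewrite (_ : j = i) //; apply/val_inj/eqP; rewrite eqn_leq ji ij.
Qed.

(** * The Khovanov differential *)

Lemma sign_succ (R : pzRingType) (n : int) : (-1) ^+ `|(n + 1)%R|%N = - ((-1) ^+ `|n|%N) :> R.
Proof.
rewrite -signr_odd -[in RHS]signr_odd (_ : odd `|(n + 1)%R|%N = ~~ odd `|n|%N); last by lia.
by case: odd; rewrite ?expr0 ?expr1 ?opprK.
Qed.

Section TotalDifferential.
Variables (k : comPzRingType) (P : shadow) (sg : crossing P -> bool).
Let D : diagram := Diagram sg.
Implicit Types (s t : state P) (v : crossing P).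

Definition raisable s v : bool := s v == ~~ sg v.

Lemma raisesE s t v : @raises D s t v = (t == flip v s) && raisable s v.
Proof.
apply/forallP/andP => [st|[/eqP-> sv] c].
  split; last by move/(_ v): st; rewrite /alpha /raisable eqxx /=;
    case: (t v); case: (s v); case: (sg v).
  apply/eqP/ffunP => c; move/(_ c): st; rewrite /alpha ffunE /=.
  by case: (c == v); case: (t c); case: (s c); case: (sg c).
rewrite /alpha ffunE /=; case: (c =P v) => [->|_]; last by rewrite addbF addr0.
by move: sv; rewrite /raisable; case: (s v); case: (sg v).
Qed.

Lemma weight_raises s t v : @raises D s t v -> @weight D t = @weight D s + 1.
Proof.
move=> /forallP st; rewrite /weight (eq_bigr _ (fun c _ => eqP (st c))) big_split /=.
by congr (_ + _); rewrite (bigD1 v) //= eqxx big1 ?addr0 // => c /negbTE->.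
Qed.

Definition total_diff : cat_alg k (@smoothing P) := fun s t =>
  cls [seq (diff_coef k (D := D) s v, saddle s t) | v <- enum (crossing P) & @raises D s t v].

Lemma total_diffE s t : total_diff s t =
  \sum_(v | @raises D s t v) gen (diff_coef k (D := D) s v) (saddle s t).
Proof. by rewrite /total_diff clsE big_map big_filter big_enum_cond. Qed.

Lemma total_diff_homogeneous :
  homogeneous (@weight D) (@weight D) 1 total_diff.
Proof.
move=> s t st; rewrite total_diffE big_pred0 // => v; apply/negP => /weight_raises E.
by rewrite E eqxx in st.
Qed.

Lemma alpha_away v s c : c != v -> @alpha D (flip v s) c = alpha (D := D) s c.
Proof. by move=> cv; rewrite /alpha flip_away. Qed.

Lemma alpha_raisable v s : raisable s v -> @alpha D (flip v s) v = alpha (D := D) s v + 1.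
Proof. by rewrite /alpha flip_at /raisable; case: (s v) => /=; case: (sg v). Qed.

Lemma diff_coef_lower v v' s : (v <= v')%N ->
  diff_coef k (D := D) (flip v s) v' = diff_coef k (D := D) s v'.
Proof.
move=> vv'; congr ((-1) ^+ `|_|%N * _); apply: eq_bigr => c v'c; apply: alpha_away.
by apply/negP => /eqP E; rewrite E ltnNge vv' in v'c.
Qed.

Lemma diff_coef_upper v v' s : (v < v')%N -> raisable s v' ->
  diff_coef k (D := D) (flip v' s) v = - diff_coef k (D := D) s v.
Proof.
move=> vv' sv'; rewrite /diff_coef -mulNr -sign_succ; congr ((-1) ^+ `|_|%N * _).
rewrite (bigD1 v') //= [in RHS](bigD1 v') //= alpha_raisable // addrAC.
congr (_ + _ + _); apply: eq_bigr => c /andP[_ cv']; exact: alpha_away.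
Qed.

(** Of two crossings, raising the larger one shifts the sign exponent at the smaller by one, and
    raising the smaller one leaves the larger unaffected. *)
Lemma diff_coef_anticommute v v' s : v != v' -> raisable s v -> raisable s v' ->
  diff_coef k (D := D) s v * diff_coef k (D := D) (flip v s) v' =
  - (diff_coef k (D := D) s v' * diff_coef k (D := D) (flip v' s) v).
Proof.
move=> vv' sv sv'; have := vv'; rewrite -val_eqE /= neq_ltn => /orP[] lt.
  by rewrite (diff_coef_lower _ (ltnW lt)) (diff_coef_upper lt) // mulrN opprK mulrC.
by rewrite (diff_coef_lower _ (ltnW lt)) (diff_coef_upper lt) // mulrN mulrC.
Qed.

(** Two saddles give the same surface in either order, with opposite signs, and no crossing can be
    raised twice. *)
Lemma total_diff_sq : total_diff * total_diff = 0.
Proof.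
apply: cat_algP => s u; rewrite cat_algM.
pose F v v' := if raisable s v && raisable (flip v s) v' && (u == flip v' (flip v s)) then
  gen (diff_coef k (D := D) s v * diff_coef k (D := D) (flip v s) v')
      (cob_comp (saddle s (flip v s)) (saddle (flip v s) u)) else 0.
transitivity (\sum_v \sum_v' F v v').
  under eq_bigr do rewrite total_diffE qcomp_suml big_mkcond.
  rewrite exchange_big; apply: eq_bigr => v _ /=.
  rewrite (bigD1 (flip v s)) //= [X in _ + X]big1 ?addr0 => [|t /negbTE ts]; last first.
    by rewrite raisesE ts.
  rewrite raisesE eqxx total_diffE /=; case: ifP => sv; last first.
    by rewrite big1 // => v' _; rewrite /F sv.
  rewrite qcomp_sumr big_mkcond; apply: eq_bigr => v' _.
  by rewrite raisesE /F sv /= andbC qcomp_gen.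
apply: sum_antisymmetric => [v|v v' vv'].
  by rewrite /F /raisable flip_at; case: (s v); case: (sg v).
have rv : raisable (flip v s) v' = raisable s v'.
  by rewrite /raisable flip_away // eq_sym.
have rv' : raisable (flip v' s) v = raisable s v by rewrite /raisable flip_away.
rewrite /F rv rv' flipC [raisable s v' && _]andbC.
case: ifP => [/andP[/andP[sv sv'] /eqP ->]|]; last by rewrite oppr0.
rewrite diff_coef_anticommute // genN flipC; congr (- _).
by apply: gen_diffeo; apply: saddles_commute.
Qed.

Lemma differential_represents n :
  represents (differential (khovanov k D) n : mor k (graded_obj (@smoothing P) (@weight D) n)
    (graded_obj (@smoothing P) (@weight D) (n + 1))) total_diff.
Proof. by []. Qed.

End TotalDifferential.

Section Shift.
Variables (k : comPzRingType) (P : shadow) (c0 : crossing P).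
Local Notation R := (cat_alg k (@smoothing P)).
Implicit Types (s t : state P).

Definition shift (b : bool) (F : forall s t, quot_hom (smoothing s) (smoothing t) k) : R :=
  fun s t => if (s c0 == b) && (t == flip c0 s) then F s t else 0.

Lemma shiftM b b' F G : shift b F * shift b' G = diag (fun s =>
  if (s c0 == b) && (b' == ~~ b) then qcomp (F s (flip c0 s)) (G (flip c0 s) s) else 0).
Proof.
apply: cat_algP => s u; rewrite cat_algM (bigD1 (flip c0 s)) //= big1 ?addr0; last first.
  by move=> t /negbTE ts; rewrite /shift ts andbF qcomp0l.
rewrite /shift eqxx andbT flip_at flipK; have [<-|su] := eqVneq s u.
  rewrite diagE andbT; case: eqP => [->|_] /=; last by rewrite qcomp0l.
  by rewrite eq_sym; case: eqP; rewrite ?qcomp0r.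
by rewrite diag0 // andbF qcomp0r.
Qed.

End Shift.

(** * The genus-one morphism *)

Section TubesOnId.
Variables (k : comPzRingType) (W0 W1 : manifold) (S : cobordism W0 W1) (a b : k).

Lemma qcomp_tube_id_l (p q : circles W0) :
  qcomp (gen a (@add_tube _ _ (cob_id W0) p q)) (gen b S) =
  gen (a * b) (@add_tube _ _ S (src S p) (src S q)).
Proof.
rewrite qcomp_gen (gen_diffeo _ (cob_comp_add_tube_l _ _ _)); apply: gen_diffeo.
exact: sheet_equiv_diffeo (add_tube_equiv (cob_id_equiv_l S) (conn_refl _ _) (conn_refl _ _)).
Qed.

Lemma qcomp_tube_id_r (p q : circles W1) :
  qcomp (gen a S) (gen b (@add_tube _ _ (cob_id W1) p q)) =
  gen (a * b) (@add_tube _ _ S (tgt S p) (tgt S q)).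
Proof.
rewrite qcomp_gen (gen_diffeo _ (cob_comp_add_tube_r _ _ _)); apply: gen_diffeo.
exact: sheet_equiv_diffeo (add_tube_equiv (cob_id_equiv_r S) (conn_refl _ _) (conn_refl _ _)).
Qed.
End TubesOnId.

Section PhiAction.
Variables (k : comPzRingType) (P : shadow) (c0 : crossing P).
Implicit Types s t : state P.

Lemma PhiE s : cls (Phi k s c0) =
  gen 1 (@add_tube _ _ (cob_id _) (left_strand s c0) (right_strand s c0)) -
  gen 1 (@add_tube _ _ (cob_id _) (left_strand s c0) (left_strand s c0)).
Proof. by rewrite clsE !big_cons big_nil addr0 /= genN. Qed.

Lemma Phi_comp s (W : manifold) (S : cobordism (smoothing s) W) (a : k) :
  qcomp (cls (Phi k s c0)) (gen a S) =
  gen a (@add_tube _ _ S (src S (left_strand s c0)) (src S (right_strand s c0))) -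
  gen a (@add_tube _ _ S (src S (left_strand s c0)) (src S (left_strand s c0))).
Proof. by rewrite PhiE qcompDl qcompNl !qcomp_tube_id_l mul1r. Qed.

Lemma comp_Phi s (W : manifold) (S : cobordism W (smoothing s)) (a : k) :
  qcomp (gen a S) (cls (Phi k s c0)) =
  gen a (@add_tube _ _ S (tgt S (left_strand s c0)) (tgt S (right_strand s c0))) -
  gen a (@add_tube _ _ S (tgt S (left_strand s c0)) (tgt S (left_strand s c0))).
Proof. by rewrite PhiE qcompDr qcompNr !qcomp_tube_id_r mulr1. Qed.

Lemma saddle_src s t e : src (saddle s t) (circle_of (W := smoothing s) e) =
  to_pi0 (join_rel (arc_next (smoothing s)) (arc_next (smoothing t))) e.
Proof. by apply: to_pi0P; apply: conn_joinl; apply: conn_val. Qed.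

Lemma saddle_tgt s t e : tgt (saddle s t) (circle_of (W := smoothing t) e) =
  to_pi0 (join_rel (arc_next (smoothing s)) (arc_next (smoothing t))) e.
Proof. by apply: to_pi0P; apply: conn_joinr; apply: conn_val. Qed.

(** The strands at [c0] are named by edges, and an edge marks the same sheet of the saddle at its
    source and at its target; tubes therefore slide across. *)
Lemma Phi_saddle s t (a : k) :
  qcomp (gen a (saddle s t)) (cls (Phi k t c0)) = qcomp (cls (Phi k s c0)) (gen a (saddle s t)).
Proof. by rewrite Phi_comp comp_Phi !saddle_src !saddle_tgt. Qed.

Lemma strands_joined s : s c0 = false ->
  conn (join_rel (arc_next (smoothing s)) (arc_next (smoothing (flip c0 s))))
    (inl (c0, false)) (inl (c0, true)).
Proof.
move=> sc0; have L := left_strandE sc0; have R := right_strandE sc0.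
move/eqP: L; move/eqP: R; rewrite !to_pi0_eq => R L.
apply: conn_trans (conn_joinl _ L) _; apply: conn_trans (conn_trace_swap (next_flip c0 s)) _.
by rewrite conn_sym; apply: conn_joinl.
Qed.

(** On the pair of pants both strands lie on one sheet, where the joining tube is a handle, so the
    two terms of [Phi] cancel. *)
Lemma Phi_merge s (a : k) : s c0 = false ->
  qcomp (cls (Phi k s c0)) (gen a (saddle s (flip c0 s))) = 0.
Proof.
by move=> sc0; rewrite Phi_comp !saddle_src (to_pi0P (strands_joined sc0)) subrr.
Qed.

Lemma split_Phi s (a : k) : s c0 = false ->
  qcomp (gen a (saddle (flip c0 s) s)) (cls (Phi k s c0)) = 0.
Proof.
move=> sc0; rewrite comp_Phi !saddle_tgt (@to_pi0P _ _ (inl (c0, false)) (inl (c0, true))).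
  by rewrite subrr.
by rewrite conn_joinC; apply: strands_joined.
Qed.

End PhiAction.

Section DifferentialAtCrossing.
Variables (k : comPzRingType) (P : shadow) (sg : crossing P -> bool) (c0 : crossing P).
Let D : diagram := Diagram sg.

(** This is the degree with [c0] left out: whatever happens at [c0] preserves it, and a saddle at
    any other crossing raises it. *)
Definition outer_weight (s : state P) : int := \sum_(c | c != c0) alpha (D := D) s c.

(** A negative crossing is raised from horizontal to vertical and a positive one from vertical to
    horizontal, hence the starting value [~~ sg c0]. *)
Definition diff_at : cat_alg k (@smoothing P) :=
  shift c0 (~~ sg c0) (fun s t : state P => gen (diff_coef k (D := D) s c0) (saddle s t)).

Lemma flip_injl v v' (s : state P) : flip v s = flip v' s -> v = v'.
Proof.
move=> E; have := congr1 (fun u : state P => u v) E; rewrite flip_at /flip ffunE.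
by case: eqP => // _; rewrite addbF; case: (s v).
Qed.

Lemma outer_weight_raises s t v : @raises D s t v -> v != c0 ->
  outer_weight t = outer_weight s + 1.
Proof.
move=> /forallP st vc0; rewrite /outer_weight (eq_bigr _ (fun c _ => eqP (st c))) big_split /=.
by congr (_ + _); rewrite (bigD1 v) //= eqxx big1 ?addr0 // => c /andP[_ /negbTE->].
Qed.

Lemma total_diff_at (s : state P) : total_diff k sg s (flip c0 s) = diff_at s (flip c0 s).
Proof.
rewrite total_diffE /diff_at /shift eqxx andbT; case: ifP => sc0.
  rewrite (big_pred1 c0) // => v; rewrite raisesE; apply/andP/eqP => [[/eqP /flip_injl <-] //|->].
  by split; [exact: eqxx | exact: sc0].
rewrite big_pred0 // => v; rewrite raisesE; apply/negP => /andP[/eqP /flip_injl <-].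
by rewrite /raisable sc0.
Qed.

Lemma diff_away_homogeneous :
  homogeneous outer_weight outer_weight 1 (total_diff k sg - diff_at).
Proof.
move=> s t st; rewrite cat_algD cat_algN; have [->|tc0] := eqVneq t (flip c0 s).
  by rewrite total_diff_at subrr.
rewrite /diff_at /shift (negbTE tc0) andbF subr0 total_diffE big_pred0 // => v.
apply/negP => stv; have [vc0|vc0] := eqVneq v c0.
  by move: stv; rewrite raisesE vc0 (negbTE tc0).
by rewrite (outer_weight_raises stv vc0) eqxx in st.
Qed.

Lemma diff_coef_sq s v : diff_coef k (D := D) s v * diff_coef k (D := D) s v = 1.
Proof.
rewrite /diff_coef mulrACA -signr_odd -expr2 sqrr_sign mul1r.
by case: ifP; rewrite ?mulr1 // mulrNN mulr1.
Qed.

End DifferentialAtCrossing.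

Section GenusOne.
Variables (k : comPzRingType) (P : shadow) (neg pos : crossing P -> bool) (c0 : crossing P).
Hypotheses (neg_c0 : neg c0 = false) (pos_c0 : pos c0 = true).
Hypothesis (neg_pos : forall c : crossing P, c != c0 -> neg c = pos c).
Hypothesis red : reducible c0.
Implicit Types s t : state P.

Local Notation R := (cat_alg k (@smoothing P)).
Local Notation Dm := (total_diff k neg).
Local Notation Dp := (total_diff k pos).
Local Notation wm := (@weight (Diagram neg)).
Local Notation wp := (@weight (Diagram pos)).
Local Notation cm s := (diff_coef k (D := Diagram neg) s c0).
Local Notation cp s := (diff_coef k (D := Diagram pos) s c0).

Let F : R := diag (ob := @smoothing P) (fun s : state P => if s c0 then 0 else cls (Phi k s c0)).

(** The coefficient of the saddle at [c0] is its own inverse and is repeated here so that the two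
    cancel. The minus sign makes up for the one in front of [Dm * s0 + s0 * Dm]. *)
Let s0 : R := shift c0 false
  (fun s t : state P => gen (- cm s) (cut_src (saddle s t) (left_strand s c0))).

(** By 4Tu the identity is the surface through the merged circle, plus a handle term, minus a
    joining tube; [Phi] is joining tube minus handle, hence the coefficient -1. *)
Let s1 : R := diag (ob := @smoothing P) (fun s : state P => if s c0 then 0 else
  gen (-1) (cut_tgt (cob_id (smoothing s)) (left_strand s c0))).

Let s2 : R := shift c0 true
  (fun s t : state P => gen (cp s) (cut_tgt (saddle s t) (left_strand t c0))).

Lemma alpha_neg_pos s c : c != c0 \/ s c0 = false ->
  alpha (D := Diagram neg) s c = alpha (D := Diagram pos) s c.
Proof.
rewrite /alpha /= => cs; have [Ec|cc0] := eqVneq c c0; last by rewrite neg_pos.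
by case: cs => [|sc0]; [rewrite Ec eqxx | rewrite Ec sc0].
Qed.

Lemma weight_neg_pos s : s c0 = false -> wm s = wp s.
Proof. by move=> sc0; apply: eq_bigr => c _; apply: alpha_neg_pos; right. Qed.

(** No saddle at [c0] connects two vertical states, and there [alpha] vanishes at [c0] for either
    sign of the crossing, so the coefficients agree too. *)
Lemma diff_neg_pos s t : s c0 = false -> t c0 = false -> Dm s t = Dp s t.
Proof.
move=> sc0 tc0; rewrite !total_diffE.
have vc0 sg v : @raises (Diagram sg) s t v -> v != c0.
  rewrite raisesE => /andP[/eqP ts _]; apply/eqP => E.
  by move: tc0; rewrite ts E flip_at sc0.
apply: eq_big => [v|v stv].
  have [->|ne] := eqVneq v c0.
    by rewrite !raisesE; case: eqP => // ts; move: tc0; rewrite ts flip_at sc0.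
  by rewrite !raisesE /raisable neg_pos.
rewrite /diff_coef /= (neg_pos (vc0 _ _ stv)); congr (gen (_ ^+ `|_|%N * _) _).
by apply: eq_bigr => c _; apply: alpha_neg_pos; right.
Qed.

(** Between a vertical and a horizontal state only the saddle at [c0] can occur, and [Phi] kills it
    on the vertical side; between vertical states [Phi] slides past the saddles. *)
Lemma Phi_chain : Dm * F = F * Dp.
Proof.
apply: cat_algP => s t; rewrite Mdiag diagM.
case sc0: (s c0); case tc0: (t c0).
- by rewrite qcomp0l qcomp0r.
- rewrite qcomp0l total_diffE qcomp_suml big1 // => v; rewrite raisesE => /andP[/eqP ts _].
  have vc0 : v = c0.
    by apply/eqP; move: tc0; rewrite ts /flip ffunE sc0 eq_sym; case: eqP.
  have st : s = flip c0 t by rewrite ts vc0 flipK.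
  by clear ts sc0; subst s; apply: split_Phi.
- rewrite qcomp0r total_diffE qcomp_sumr big1 // => v; rewrite raisesE => /andP[/eqP ts _].
  have vc0 : v = c0.
    by apply/eqP; move: tc0; rewrite ts /flip ffunE sc0 eq_sym; case: eqP.
  by clear tc0; subst t; rewrite vc0; apply: Phi_merge.
rewrite -(diff_neg_pos sc0 tc0) total_diffE qcomp_suml qcomp_sumr.
by apply: eq_bigr => v _; apply: Phi_saddle.
Qed.

Lemma cap_Phi : s0 * F = 0.
Proof.
apply: cat_algP => s t; rewrite Mdiag /s0 /shift; case: ifP; last by rewrite qcomp0l.
by case/andP => /eqP sc0 /eqP->; rewrite flip_at sc0 qcomp0r.
Qed.

Lemma Phi_birth : F * s2 = 0.
Proof.
apply: cat_algP => s t; rewrite diagM /s2 /shift; case: eqP => [->|]; last by rewrite qcomp0r.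
by rewrite qcomp0l.
Qed.

Lemma diagD (A B : forall s : state P, quot_hom (smoothing s) (smoothing s) k) :
  (diag A : R) + diag B = diag (fun s => A s + B s).
Proof.
apply: cat_algP => s t; rewrite cat_algD.
by have [<-|st] := eqVneq s t; rewrite ?diagE // !diag0 // addr0.
Qed.

Lemma diagN (A : forall s : state P, quot_hom (smoothing s) (smoothing s) k) :
  - (diag A : R) = diag (fun s => - A s).
Proof.
apply: cat_algP => s t; rewrite cat_algN.
by have [<-|st] := eqVneq s t; rewrite ?diagE // !diag0 // oppr0.
Qed.

Lemma diag_diag (A B : forall s : state P, quot_hom (smoothing s) (smoothing s) k) :
  (diag A : R) * diag B = diag (fun s => qcomp (A s) (B s)).
Proof.
apply: cat_algP => s t; rewrite diagM.
by have [<-|st] := eqVneq s t; rewrite ?diagE // !diag0 // qcomp0r.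
Qed.

Lemma eq_diag (A B : forall s : state P, quot_hom (smoothing s) (smoothing s) k) :
  (forall s, A s = B s) -> (diag A : R) = diag B.
Proof.
move=> AB; apply: cat_algP => s t.
have [<-|st] := eqVneq s t; first by rewrite !diagE; exact: AB.
by rewrite (diag0 A st) (diag0 B st).
Qed.

Lemma cm_flip s : cm (flip c0 s) = cm s.
Proof. exact: (@diff_coef_lower k P neg c0 c0 s (leqnn c0)). Qed.

Lemma cp_flip s : cp (flip c0 s) = cp s.
Proof. exact: (@diff_coef_lower k P pos c0 c0 s (leqnn c0)). Qed.

(* 4Tu for the discs a and b bounded by the incoming and the outgoing left strand
   and the cylinder c on the right strand: ab + ac = aa + bc. *)
Lemma row_homotopy_neg :
  F * s1 - (diff_at k neg c0 * s0 + s0 * diff_at k neg c0) = 1.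
Proof.
rewrite /diff_at neg_c0 /s0 !shiftM /F /s1 diag_diag diagD diagN diagD cat_alg1.
apply: eq_diag => s; case sc0: (s c0) => /=.
  (* At a horizontal state [F] vanishes and only the split followed by the cap remains; the state is
     then rewritten as the flip of a vertical one. *)
  rewrite qcomp0r add0r addr0 qcomp_gen mulrN cm_flip diff_coef_sq genN opprK.
  move: (flip c0 s) (flipK c0 s) => s' E.
  have s'c0 : s' c0 = false by move: sc0; rewrite -E flip_at; case: (s' c0).
  by case: s / E sc0 => _; apply/gen_diffeo/cap_after_split.
rewrite add0r Phi_comp qcomp_gen mulNr cm_flip diff_coef_sq !genN !opprK.
rewrite (gen_diffeo _ (split_after_cap red sc0)).
set L := left_strand s c0; set I := cut_tgt _ L.
rewrite [qid _ _](gen_diffeo _ (@cut_tgt_tube _ _ (cob_id (smoothing s)) L)).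
have E := @gen_4Tu k _ _ 1 I (Some L) None (Some L) (Some (right_strand s c0)).
by rewrite -addrA -E addrC addrK.
Qed.

(* The same with ab + cb = ac + bb. *)
Lemma row_homotopy_pos :
  s1 * F + (diff_at k pos c0 * s2 + s2 * diff_at k pos c0) = 1.
Proof.
rewrite /diff_at pos_c0 /s2 !shiftM /F /s1 diag_diag !diagD cat_alg1.
apply: eq_diag => s; case sc0: (s c0) => /=.
  rewrite qcomp0r !add0r qcomp_gen cp_flip diff_coef_sq.
  move: (flip c0 s) (flipK c0 s) => s' E.
  have s'c0 : s' c0 = false by move: sc0; rewrite -E flip_at; case: (s' c0).
  by case: s / E sc0 => _; apply/gen_diffeo/merge_after_birth.
rewrite comp_Phi.
rewrite qcomp_gen.
rewrite addr0 cp_flip diff_coef_sq !genN !opprK.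
rewrite (gen_diffeo _ (birth_after_merge red sc0)).
set L := left_strand s c0; set Rt := right_strand s c0; set I := cut_tgt _ L.
have -> : tgt I L = None by rewrite /= eqxx.
have -> : tgt I Rt = Some Rt.
  rewrite /= /L /Rt left_strandE // right_strandE // to_pi0_eq conn_sym.
  by rewrite (negbTE (strands_differ red sc0)).
rewrite [qid _ _](gen_diffeo _ (@cut_tgt_tube _ _ (cob_id (smoothing s)) L)).
have E := @gen_4Tu k _ _ 1 I (Some L) None (Some Rt) None.
rewrite [gen 1 (@add_tube _ _ I (Some Rt) None)](gen_diffeo _ (add_tubeC _ _)) in E.
by rewrite -addrA [X in _ + X]addrC -E addrC addrK.
Qed.

Let Phi_homogeneous : homogeneous wm wp 0 F.
Proof.
apply: homogeneous_diag => s; case sc0: (s c0) => //.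
by rewrite (weight_neg_pos sc0) eqxx.
Qed.

Let disc_homogeneous : homogeneous wp wm 0 s1.
Proof.
apply: homogeneous_diag => s; case sc0: (s c0) => //.
by rewrite (weight_neg_pos sc0) eqxx.
Qed.

Let cap_homogeneous : homogeneous wm wm (-1) s0.
Proof.
move=> s t; rewrite /s0 /shift; case: ifP => // /andP[/eqP sc0 /eqP ->].
have /weight_raises -> : @raises (Diagram neg) (flip c0 s) s c0.
  by rewrite raisesE flipK eqxx /raisable flip_at sc0 neg_c0.
by rewrite addrK eqxx.
Qed.

Let birth_homogeneous : homogeneous wp wp (-1) s2.
Proof.
move=> s t; rewrite /s2 /shift; case: ifP => // /andP[/eqP sc0 /eqP ->].
have /weight_raises -> : @raises (Diagram pos) (flip c0 s) s c0.
  by rewrite raisesE flipK eqxx /raisable flip_at sc0 pos_c0.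
by rewrite addrK eqxx.
Qed.

Let shift_outer sg b G : homogeneous (outer_weight sg c0) (outer_weight sg c0) 0
  (shift (k := k) c0 b G).
Proof.
move=> s t; rewrite /shift; case: ifP => // /andP[_ /eqP ->].
rewrite addr0 /outer_weight (eq_bigr (fun c => alpha (D := Diagram sg) s c)) ?eqxx // => c cc0.
by rewrite /alpha flip_away.
Qed.

Let a1 := F * s1 - (Dm * s0 + s0 * Dm).
Let a2 := s1 * F + (Dp * s2 + s2 * Dp).

(** By [row_homotopy_neg] the saddle at [c0] accounts for the summand 1; the rest comes from the
    other crossings and raises [outer_weight]. Degree 0 for [wm] is what lets the inverse act on the
    graded complex. *)
Let a1_inverse : exists u, [/\ u * a1 = 1, a1 * u = 1 & homogeneous wm wm 0 u].
Proof.
have hD := @total_diff_homogeneous k P neg.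
apply: (homogeneous_inverse (w' := outer_weight neg c0)).
  have h := homogeneousM Phi_homogeneous disc_homogeneous; rewrite addr0 in h.
  apply: homogeneousD h _; apply: homogeneousN.
  have := homogeneousM hD cap_homogeneous; rewrite subrr => h1.
  have := homogeneousM cap_homogeneous hD; rewrite addNr => h2.
  exact: homogeneousD h1 h2.
have hd := @diff_away_homogeneous k P neg c0; set d := _ - _ in hd.
have Dd : Dm = diff_at k neg c0 + d by rewrite addrC subrK.
have -> : a1 - 1 = - (d * s0 + s0 * d).
  have ar (x y z : R) : x - (y + z) - (x - y) = - z.
    by rewrite (opprD y z) opprB addrC !addrA subrK subrr sub0r.
  by rewrite -row_homotopy_neg /a1 Dd mulrDl mulrDr addrACA ar.
have hs : homogeneous (outer_weight neg c0) (outer_weight neg c0) 0 s0 by apply: shift_outer.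
have := homogeneousM hd hs; rewrite addr0 => h1.
have := homogeneousM hs hd; rewrite add0r => h2.
by apply: homogeneousN; apply: homogeneousD h1 h2.
Qed.

Let a2_inverse : exists u, [/\ u * a2 = 1, a2 * u = 1 & homogeneous wp wp 0 u].
Proof.
have hD := @total_diff_homogeneous k P pos.
apply: (homogeneous_inverse (w' := outer_weight pos c0)).
  have h := homogeneousM disc_homogeneous Phi_homogeneous; rewrite addr0 in h.
  apply: homogeneousD h _.
  have := homogeneousM hD birth_homogeneous; rewrite subrr => h1.
  have := homogeneousM birth_homogeneous hD; rewrite addNr => h2.
  exact: homogeneousD h1 h2.
have hd := @diff_away_homogeneous k P pos c0; set d := _ - _ in hd.
have Dd : Dp = diff_at k pos c0 + d by rewrite addrC subrK.
have -> : a2 - 1 = d * s2 + s2 * d.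
  have ar (x y z : R) : x + (y + z) - (x + y) = z by rewrite addrA (addrC (x + y)) addrK.
  by rewrite -row_homotopy_pos /a2 Dd mulrDl mulrDr addrACA ar.
have hs : homogeneous (outer_weight pos c0) (outer_weight pos c0) 0 s2 by apply: shift_outer.
have := homogeneousM hd hs; rewrite addr0 => h1.
have := homogeneousM hs hd; rewrite add0r => h2.
exact: homogeneousD h1 h2.
Qed.

Let genus_one_represents n :
  represents (genus_one (k := k) (neg := neg) (pos := pos) c0 n :
    mor k (graded_obj (@smoothing P) wm n) (graded_obj (@smoothing P) wp n)) F.
Proof.
move=> [s si] [t tj]; rewrite /genus_one /=; have [e|ne] := eqVneq s t.
  subst t; rewrite /F diagE; case: (s =P s) => // e; rewrite (eq_axiomK e) /=.
  by case: (s c0).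
by rewrite /F diag0 //; case: eqP ne => // ->; rewrite eqxx.
Qed.

Lemma genus_one_equivalence : chain_homotopy_equivalence
  (genus_one c0 : graded_mor (khovanov k (Diagram neg)) (khovanov k (Diagram pos))).
Proof.
have [u1 [u1a1 a1u1 hu1]] := a1_inverse.
have [u2 [u2a2 a2u2 hu2]] := a2_inverse.
have Dm2 := @total_diff_sq k P neg; have Dp2 := @total_diff_sq k P pos.
have hDm := @total_diff_homogeneous k P neg; have hDp := @total_diff_homogeneous k P pos.
have rDm := @differential_represents k P neg; have rDp := @differential_represents k P pos.
pose G : R := perturbed_inverse Dm Dp s1 s2 u1 u2.
have FG : F * G = 1 + (Dm * (s0 * u1) + s0 * u1 * Dm).
  exact: (perturbed_inverse_l Dm2 Phi_chain cap_Phi Phi_birth u1a1 a1u1 a2u2).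
have GF : G * F = 1 - (Dp * (s2 * u2) + s2 * u2 * Dp).
  exact: (perturbed_inverse_r Dp2 Phi_chain cap_Phi Phi_birth u1a1 u2a2 a2u2).
have GD : Dp * G = G * Dm.
  exact: (perturbed_inverse_chain Dm2 Dp2 Phi_chain cap_Phi Phi_birth u1a1 a1u1 u2a2 a2u2).
have hG : homogeneous wp wm 0 G.
  have h1 := homogeneousM disc_homogeneous hu1.
  have h2 := homogeneousM birth_homogeneous hu2.
  have h3 := homogeneousM hDp disc_homogeneous; have h4 := homogeneousM disc_homogeneous hDm.
  rewrite addr0 in h1; rewrite addr0 in h3; rewrite add0r in h4.
  have h5 := homogeneousM h2 (homogeneousD h3 (homogeneousN h4)).
  have h6 := homogeneousM h5 hu1; rewrite !addr0 addNr in h6.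
  exact: homogeneousD h1 (homogeneousN h6).
have hsm : homogeneous wm wm (-1) (s0 * u1).
  by have := homogeneousM cap_homogeneous hu1; rewrite addr0.
(* [homotopic] adds the homotopy terms, whereas [GF] subtracts them, so the sign moves into the
   homotopy. *)
have hsp : homogeneous wp wp (-1) (- (s2 * u2)).
  by apply: homogeneousN; have := homogeneousM birth_homogeneous hu2; rewrite addr0.
have comp := @represents_comp k _ (@smoothing P).
have part := @graded_part_represents k _ (@smoothing P).
have rF := genus_one_represents; have n0 (n : int) : n = n + 0 by rewrite addr0.
have nN (n : int) : n = n + 1 + -1 by rewrite addrK.
split.
- move=> n; apply: (@represents_eq k _ (@smoothing P) wm wm n (n + 1 + 1) _ _ 0) => //.
  by rewrite -Dm2; exact: (comp wm wm wm n (n + 1) _ 1 _ _ _ _ (rDm _) (rDm _) hDm).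
- move=> n; apply: (@represents_eq k _ (@smoothing P) wp wp n (n + 1 + 1) _ _ 0) => //.
  by rewrite -Dp2; exact: (comp wp wp wp n (n + 1) _ 1 _ _ _ _ (rDp _) (rDp _) hDp).
- move=> n; apply: (@represents_eq k _ (@smoothing P) wm wp n (n + 1) _ _ (F * Dp)).
    exact: (comp wm wp wp n n _ 0 _ _ _ _ (rF n) (rDp n) Phi_homogeneous (n0 n)).
  rewrite -Phi_chain.
  exact: (comp wm wm wp n (n + 1) _ 1 _ _ _ _ (rDm n) (rF (n + 1)) hDm).
exists (fun n => graded_part G); split.
- move=> n; apply: (@represents_eq k _ (@smoothing P) wp wm n (n + 1) _ _ (G * Dm)).
    exact: (comp wp wm wm n n _ 0 _ _ _ _ (part _ _ _ _ G) (rDm n) hG (n0 n)).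
  rewrite -GD.
  exact: (comp wp wp wm n (n + 1) _ 1 _ _ _ _ (rDp n) (part _ _ _ _ G) hDp).
- exists (fun n => graded_part (s0 * u1)) => n.
  apply: (@represents_eq k _ (@smoothing P) wm wm (n + 1) (n + 1) _ _ (F * G)).
    exact: (comp wm wp wm _ (n + 1) _ 0 _ _ _ _ (rF _) (part _ _ _ _ G) Phi_homogeneous (n0 _)).
  rewrite FG [_ + s0 * u1 * Dm]addrC.
  apply: represents_add; first exact: represents_id.
  apply: represents_add.
    exact: (comp wm wm wm (n + 1) n (n + 1) (-1) _ _ _ _ (part _ _ _ _ _) (rDm _) hsm (nN _)).
  exact: (comp wm wm wm (n + 1) (n + 1 + 1) _ 1 _ _ _ _ (rDm _) (part _ _ _ _ _) hDm).
exists (fun n => graded_part (- (s2 * u2))) => n.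
apply: (@represents_eq k _ (@smoothing P) wp wp (n + 1) (n + 1) _ _ (G * F)).
  exact: (comp wp wm wp _ (n + 1) _ 0 _ _ _ _ (part _ _ _ _ G) (rF _) hG (n0 _)).
rewrite GF opprD [_ - s2 * u2 * Dp]addrC -[- (s2 * u2 * Dp)]mulNr -[- (Dp * _)]mulrN.
apply: represents_add; first exact: represents_id.
apply: represents_add.
  exact: (comp wp wp wp (n + 1) n (n + 1) (-1) _ _ _ _ (part _ _ _ _ _) (rDp _) hsp (nN _)).
exact: (comp wp wp wp (n + 1) (n + 1 + 1) _ 1 _ _ _ _ (rDp _) (part _ _ _ _ _) hDp).
Qed.

End GenusOne.

Theorem theorem3 (k : comPzRingType) (P : shadow)
    (neg pos : crossing P -> bool) (c0 : crossing P) :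
  neg c0 = false -> pos c0 = true ->
  (forall c : crossing P, c != c0 -> neg c = pos c) ->
  reducible c0 ->
  chain_homotopy_equivalence
    (genus_one c0 :
       graded_mor (khovanov k (Diagram neg)) (khovanov k (Diagram pos))).
Proof. exact: genus_one_equivalence. Qed.
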